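(* There exist an absolute constant $c>0$ and a positive integer $n_0$ such that the following holds. Let $\mathcal{V}$ be a set of $n \geq n_0$ points in $\mathbb{C}^3$ such that at most $\frac{2}{3}n$ points of $\mathcal{V}$ are contained in any (complex affine) plane. Then \[ t_2(\mathcal{V}) \geq \frac{3}{2}n + c\sum_{r\geq 4} r^2\, t_r(\mathcal{V}). \]
   Context: For a finite point set $\mathcal{V}$, $t_r(\mathcal{V})$ denotes the number of (complex affine) lines containing exactly $r$ points of $\mathcal{V}$. In particular $t_2(\mathcal{V})$ is the number of ordinary lines. *)

(* Defs.v *)
From HB Require Import structures.
From mathcomp Require Import all_boot all_order all_algebra finmap.
From mathcomp Require Import complex.
From mathcomp Require Import all_classical reals.

Set Implicit Arguments.
Unset Strict Implicit.
Unset Printing Implicit Defensive.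

Import Order.TTheory GRing.Theory Num.Theory.

Local Open Scope fset_scope.
Local Open Scope classical_set_scope.
Local Open Scope ring_scope.

Definition affine_flat (F : fieldType) (vT : vectType F) (d : nat)
    (A : set vT) : Prop :=
  exists (p : vT) (U : {vspace vT}), \dim U = d /\ A = [set x | x - p \in U].

Definition is_line (F : fieldType) (vT : vectType F) (L : set vT) : Prop :=
  affine_flat 1 L.

Definition is_plane (F : fieldType) (vT : vectType F) (H : set vT) : Prop :=
  affine_flat 2 H.

Definition npoints_on (T : choiceType) (V : {fset T}) (A : set T) : nat :=
  #|` [fset x in V | x \in A] |.

Definition lines_with (F : fieldType) (vT : vectType F) (V : {fset vT})
    (r : nat) : set (set vT) :=
  [set L | is_line L /\ npoints_on V L = r].

(* The set of lines meeting V in exactly r points is finite as soon as 2 <= r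
   (see finite_lines_with); for r = 0, 1 it is infinite in dimension at least 2
   over an infinite field, and t_ r V takes the default value 0 of fset_set. *)
Definition t_ (F : fieldType) (vT : vectType F) (r : nat) (V : {fset vT}) : nat :=
  #|` fset_set (lines_with V r) |.

Lemma is_lineE (F : fieldType) (vT : vectType F) (L : set vT) (a b : vT) :
  is_line L -> L a -> L b -> a != b -> L = [set x | x - a \in <[b - a]>%VS].
Proof.
move=> [p [U [dU ->]]] /= La Lb ab.
have ba : b - a \in U.
  have -> : b - a = (b - p) - (a - p) by rewrite opprB addrA subrK.
  exact: memvB.
have -> : <[b - a]>%VS = U.
  apply/eqP; rewrite eqEdim -memvE ba dU dim_vline.
  by rewrite subr_eq0 eq_sym ab.
apply/seteqP; split=> x /= Hx.
  have -> : x - a = (x - p) - (a - p) by rewrite opprB addrA subrK.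
  exact: memvB.
have -> : x - p = (x - a) + (a - p) by rewrite addrA subrK.
exact: memvD.
Qed.

Lemma finite_lines_with (F : fieldType) (vT : vectType F) (V : {fset vT})
  (r : nat) : (2 <= r)%N -> finite_set (lines_with V r).
Proof.
move=> r2.
pose f (ab : vT * vT) : set vT := [set x | x - ab.1 \in <[ab.2 - ab.1]>%VS].
apply: (@sub_finite_set _ _ (f @` ([set` V] `*` [set` V]))); last first.
  by apply: finite_image; apply: finite_setX; exact: finite_fset.
move=> L [lL nL].
have : (1 < #|` [fset x in V | x \in L]%fset |)%N.
  by rewrite -/(npoints_on V L) nL.
set S := [fset x in V | x \in L]%fset => S2.
have [a aS] : exists a, a \in S by apply/fset0Pn; rewrite -cardfs_gt0 ltnW.
have [b] : exists b, b \in (S `\ a)%fset.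
  by apply/fset0Pn; rewrite -cardfs_gt0; move: S2; rewrite (cardfsD1 a) aS.
rewrite !inE => /andP[ba /andP[bV bL]].
move: aS; rewrite !inE => /andP[aV aL].
exists (a, b); first by split.
rewrite /f /=; apply/esym/is_lineE => //; last by rewrite eq_sym.
- exact: set_mem.
- exact: set_mem.
Qed.

Lemma t_gt_card (F : fieldType) (vT : vectType F) (V : {fset vT}) (r : nat) :
  (#|` V | < r)%N -> t_ r V = 0%N.
Proof.
move=> ltVr; rewrite /t_ (_ : lines_with V r = set0).
  by rewrite fset_set0 cardfs0.
rewrite -subset0 => L [_ nL]; move: ltVr; rewrite -nL ltnNge => /negP; apply.
apply: fsubset_leq_card; apply/fsubsetP => x.
by rewrite !inE => /andP[].
Qed.

(* Main.v *)
Require Import Defs.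
From HB Require Import structures.
From mathcomp Require Import all_boot all_order all_algebra finmap.
From mathcomp Require Import zify ring lra.
From mathcomp Require Import complex.
From mathcomp Require Import all_classical reals exp.

Set Implicit Arguments.
Unset Strict Implicit.
Unset Printing Implicit Defensive.

Import Order.TTheory GRing.Theory Num.Theory.

Local Open Scope ring_scope.

(* For a collinear triple i, j, k and a linear form f separating the points, the
   coefficients f j - f k, f k - f i, f i - f j give an affine dependency. These
   dependencies, each weighted by 1/(r - 2) when its line carries r points, form
   a matrix that annihilates the constant function and the three coordinate
   functions, so its Gram matrix M has a kernel of dimension at least 4 when the
   points are not coplanar, and (tr M)^2 <= (n - 4) sum |M_ij|^2.

   If every point lies on at most (n-1)/2 ordinary lines, and there are at most
   n^2/12 of these, the matrix can be scaled so that all rows and (up to an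
   arbitrarily small error) all columns have constant norm. Then the off-diagonal
   part of M is at most 4/9 of the total weight, minus a gain: inside a
   line with four or more points the coefficient ratios of two points differ from
   triple to triple, which makes the Cauchy-Schwarz step strict by a fixed amount.
   Solving the inequality for the number of ordinary pairs gives
   3n + c * #{pairs on lines with at least four points}.

   A point on more than (n-1)/2 ordinary lines is removed, at the cost of a number
   of ordinary pairs linear in n. Either the process stops while more than 5n/6
   points, hence a non-coplanar set, remain, or quadratically many ordinary pairs
   have been found. *)

(** * Approximate matrix scaling by minimising a potential *)

Section Scaling.
Variables (R : realType) (I T : finType) (om : I -> R) (m : R).
Hypothesis om_ge0 : forall r, 0 <= om r.
Hypothesis m_def : m = \sum_r om r.

Definition meets (S : I -> T -> bool) (B : {set T}) (r : I) :=
  [exists i in B, S r i].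

(** A Hall-type condition: it is what keeps the potential below bounded from under, and hence allows
    constant row sums together with almost constant column sums. *)
Definition scalable_design (S : I -> T -> bool) :=
  forall B : {set T}, m * #|B|%:R <= #|T|%:R * \sum_(r | meets S B r) om r.

(** Induction on the size of the support [B] of [x]: the least positive value [d] is subtracted from
    [x] on [B] and from [M] on the rows meeting [B]. The design condition for [B], multiplied by
    [d], pays for the difference. *)
Lemma layer_cake_ge0 (S : I -> T -> bool) (x : T -> R) (M : I -> R) :
  scalable_design S ->
  (forall i, 0 <= x i) -> (forall r, 0 <= M r) ->
  (forall r i, S r i -> x i <= M r) ->
  m * \sum_i x i <= #|T|%:R * \sum_r om r * M r.
Proof.
move=> hS; have [k] := ubnP #|[set i | 0 < x i]|.
elim: k => // k IH in x M *; rewrite ltnS => hk x0 M0 hM.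
set B := [set i | 0 < x i] in hk.
have [B0|/finset.set0Pn[i0 i0B]] := eqVneq B finset.set0.
  rewrite big1 => [|i _]; last first.
    apply/eqP; rewrite eq_le x0 andbT leNgt; apply/negP => xi.
    by have : i \in B by [rewrite inE]; rewrite B0 inE.
  rewrite mulr0 mulr_ge0 // sumr_ge0 // => r _.
  exact: mulr_ge0.
pose j := [arg min_(i < i0 in B) x i]%O.
have [jB jmin] : j \in B /\ forall i, i \in B -> x j <= x i.
  by rewrite /j; case: arg_minP.
set d := x j in jmin.
have d0 : 0 < d by move: jB; rewrite inE.
pose x' i := x i - d * (i \in B)%:R.
pose M' r := M r - d * (meets S B r)%:R.
have H := IH x' M'; move: H.
have -> : \sum_i x' i = \sum_i x i - d * #|B|%:R.
  rewrite /x' big_split /= sumrN -mulr_sumr; congr (_ - _ * _).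
  by rewrite -sum1_card natr_sum [RHS]big_mkcond; apply: eq_bigr => i _; case: ifP.
have -> : \sum_r om r * M' r =
    \sum_r om r * M r - d * \sum_(r | meets S B r) om r.
  rewrite (big_mkcond (meets S B)) mulr_sumr -sumrB; apply: eq_bigr => r _.
  by rewrite /M'; case: (meets S B r) => /=; ring.
move=> H; move: (hS B) => hB.
rewrite -subr_ge0.
set X := \sum_i x i in H *; set Y := \sum_r om r * M r in H *.
set Z := \sum_(r | _) om r in H hB.
have : m * (X - d * #|B|%:R) <= #|T|%:R * (Y - d * Z).
  apply: H.
  - apply: leq_trans hk; apply: proper_card; apply/properP; split.
      apply/fintype.subsetP => i; rewrite !inE /x'; case: (boolP (i \in B)) => [|_].
        by rewrite inE.
      by rewrite mulr0 subr0.
    by exists j => //; rewrite inE /x' jB mulr1 subrr ltxx.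
  - move=> i; rewrite /x'; case: (boolP (i \in B)) => [iB|_].
      by rewrite mulr1 subr_ge0 jmin.
    by rewrite mulr0 subr0.
  - move=> r; rewrite /M'; case: (boolP (meets S B r)) => [/existsP[i /andP[iB Si]]|_].
      by rewrite mulr1 subr_ge0 (le_trans (jmin _ iB)) // hM.
    by rewrite mulr0 subr0.
  - move=> r i Si; rewrite /M' /x'; case: (boolP (i \in B)) => [iB|iB].
      have -> : meets S B r by apply/existsP; exists i; rewrite iB.
      by rewrite lerD2r hM.
    have xi0 : x i = 0.
      by apply/eqP; rewrite eq_le x0 andbT leNgt; move: iB; rewrite inE.
    rewrite xi0 mulr0 subr0; case: (boolP (meets S B r)) => [/existsP[l /andP[lB Sl]]|_].
      by rewrite mulr1 subr_ge0 (le_trans (jmin _ lB)) // hM.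
    by rewrite mulr0 subr0.
rewrite !mulrBr; move: hB; rewrite -(ler_pM2l d0); lra.
Qed.

(** Adding a large constant [K] to [x] and [M] makes both nonnegative; as the weights sum to [m],
    both sides grow by [m * #|T| * K]. *)
Lemma layer_cake (S : I -> T -> bool) (x : T -> R) (M : I -> R) :
  scalable_design S ->
  (forall r i, S r i -> x i <= M r) ->
  m * \sum_i x i <= #|T|%:R * \sum_r om r * M r.
Proof.
move=> hS hM; pose K := \sum_i `|x i| + \sum_r `|M r|.
have Kx i : 0 <= x i + K.
  rewrite /K (bigD1 i) //=.
  have := ler_norm (- x i); rewrite normrN.
  have : 0 <= \sum_(j | j != i) `|x j| by apply: sumr_ge0.
  have : 0 <= \sum_r `|M r| by apply: sumr_ge0.
  lra.
have KM r : 0 <= M r + K.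
  rewrite /K (bigD1 (P := predT) (F := fun r => `|M r|) r) //=.
  have := ler_norm (- M r); rewrite normrN.
  have : 0 <= \sum_(j | j != r) `|M j| by apply: sumr_ge0.
  have : 0 <= \sum_i `|x i| by apply: sumr_ge0.
  lra.
have := layer_cake_ge0 hS Kx KM (fun r i Si => lerD (hM r i Si) (lexx K)).
rewrite big_split /= sumr_const cardT -cardE.
have -> : \sum_r om r * (M r + K) = \sum_r om r * M r + m * K.
  by rewrite m_def mulr_suml -big_split; apply: eq_bigr => r _; rewrite mulrDr.
rewrite -mulr_natl; lra.
Qed.

Variable b : I -> T -> R.
Hypothesis b_ge0 : forall r i, 0 <= b r i.
Hypothesis b_design : scalable_design (fun r i => 0 < b r i).
Hypothesis om_supp : forall r, 0 < om r -> exists i, 0 < b r i.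

Definition rowsum (y : T -> R) r := \sum_i b r i * y i.

Definition colsum (y : T -> R) i := \sum_r om r * (b r i * y i / rowsum y r).

(** Its partial derivative in [ln (y i)] is [#|T| * colsum y i - m], so a critical point is an exact
    scaling. *)
Let potential (y : T -> R) :=
  #|T|%:R * \sum_r om r * ln (rowsum y r) - m * \sum_i ln (y i).

(** [rowsum] dominates each of its terms, so [ln (y i)] is at most [ln (rowsum y r)] plus a constant
    depending only on [b]; [layer_cake] applies to these logarithms. *)
Let potential_lb : exists K, forall y, (forall i, 0 < y i) -> K <= potential y.
Proof.
pose L r := \sum_i `|ln (b r i)|.
exists (- (#|T|%:R * \sum_r om r * L r)) => y y0.
have := @layer_cake (fun r i => 0 < b r i) (fun i => ln (y i))
   (fun r => ln (rowsum y r) + L r) b_design _.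
have -> : \sum_r om r * (ln (rowsum y r) + L r) =
    \sum_r om r * ln (rowsum y r) + \sum_r om r * L r.
  by rewrite -big_split; apply: eq_bigr => r _; rewrite mulrDr.
move=> H; rewrite /potential.
suff: m * (\sum_i ln (y i)) <= #|T|%:R * (\sum_r om r * ln (rowsum y r) + \sum_r om r * L r).
  lra.
apply: H => r i bri.
have h1 : b r i * y i <= rowsum y r.
  rewrite /rowsum (bigD1 i) //= lerDl sumr_ge0 // => j _.
  by rewrite mulr_ge0 // ltW.
have by0 : 0 < b r i * y i by rewrite mulr_gt0.
have : ln (b r i * y i) <= ln (rowsum y r).
  by rewrite ler_ln // posrE (lt_le_trans by0).
rewrite lnM ?posrE //.
have : `|ln (b r i)| <= L r.
  by rewrite /L (bigD1 i) //= lerDl sumr_ge0.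
have := ler_norm (- ln (b r i)); rewrite normrN.
lra.
Qed.

Lemma rowsum_gt0 (y : T -> R) r :
  (forall i, 0 < y i) -> 0 < om r -> 0 < rowsum y r.
Proof.
move=> y0 /om_supp[i bi]; rewrite /rowsum (bigD1 i) //=.
apply: ltr_pwDl; first by rewrite mulr_gt0.
by rewrite sumr_ge0 // => j _; rewrite mulr_ge0 // ltW.
Qed.

(* Multiplying y_i by 1+t changes the potential by at most
   t (n s_i - m / (1+t)), so near the infimum no s_i is much below m/n. *)
Lemma approx_scaling (d : R) : 0 < d ->
  exists y : T -> R, (forall i, 0 < y i) /\
    forall i, m - d <= #|T|%:R * colsum y i.
Proof.
move=> d0.
have m0 : 0 <= m by rewrite m_def sumr_ge0.
pose E : set R := [set v | exists2 y : T -> R, (forall i, 0 < y i) & v = potential y]%classic.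
have hE : has_inf E.
  split; first by exists (potential (fun=> 1)), (fun=> 1).
  have [K hK] := potential_lb; exists K => _ [y y0 ->]; exact: hK.
(* This size of [t] keeps the second-order loss [m * t ^ 2] within [t * d / 2]; a deficient column
   would then lower the potential by at least [t * d / 2], past the infimum. *)
have [t t0 tm] : exists2 t, 0 < t & m * t <= d / 2.
  have m1 : 0 < 2 * (m + 1) by lra.
  exists (d / (2 * (m + 1))); first by rewrite divr_gt0.
  rewrite mulrA ler_pdivrMr //; nra.
have e0 : 0 < t * d / 2 by rewrite !mulr_gt0 ?invr_gt0.
have [_ [y y0 ->] hy] := inf_adherent e0 hE.
exists y; split => // i; rewrite leNgt; apply/negP => hi.
pose y' j := if j == i then y j * (1 + t) else y j.
have y'0 j : 0 < y' j.
  rewrite /y'; case: ifP => // _; apply: mulr_gt0 => //; lra.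
have : inf E <= potential y'.
  by apply: ge_inf; [exact: hE.2|exists y'].
have h1 : \sum_j ln (y' j) = \sum_j ln (y j) + ln (1 + t).
  rewrite (bigD1 i) //= [in RHS](bigD1 i) //= {1}/y' eqxx lnM ?posrE //; last lra.
  rewrite -addrA [ln (1 + t) + _]addrC addrA; congr (_ + _ + _).
  by apply: eq_bigr => j /negbTE ji; rewrite /y' ji.
have h2 : t / (1 + t) <= ln (1 + t).
  have t1 : 0 < 1 + t by lra.
  have := @le_ln1Dx R (- (t / (1 + t))).
  have -> : 1 + - (t / (1 + t)) = (1 + t)^-1.
    by field; lra.
  rewrite lnV ?posrE // => H.
  suff: - ln (1 + t) <= - (t / (1 + t)) by lra.
  by apply: H; rewrite ltrN2 ltr_pdivrMr // mul1r; lra.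
have h3 : \sum_r om r * ln (rowsum y' r) <= \sum_r om r * ln (rowsum y r) + t * colsum y i.
  rewrite /colsum mulr_sumr -big_split; apply: ler_sum => r _ /=.
  have := om_ge0 r; rewrite le_eqVlt => /predU1P[<-|om0].
    by rewrite !mul0r mulr0 addr0.
  have r0 := rowsum_gt0 y0 om0.
  have -> : rowsum y' r = rowsum y r * (1 + t * (b r i * y i / rowsum y r)).
    rewrite mulrDr mulr1 [rowsum y r * (t * _)]mulrC -!mulrA mulVf ?gt_eqF // mulr1.
    rewrite /rowsum (bigD1 i) //= [in RHS](bigD1 i) //= /y' eqxx.
    rewrite (eq_bigr (fun j => b r j * y j)); first by ring.
    by move=> j /negbTE ->.
  have p0 : 0 <= t * (b r i * y i / rowsum y r).
    by rewrite !mulr_ge0 ?invr_ge0 // ltW.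
  rewrite lnM ?posrE //; last by lra.
  rewrite [t * (om r * _)]mulrCA -mulrDr ler_pM2l // lerD2l.
  by apply: le_ln1Dx; lra.
rewrite /potential h1 => h4.
move: hy; rewrite /potential => hy.
have h5 : #|T|%:R * (\sum_r om r * ln (rowsum y' r)) <=
  #|T|%:R * (\sum_r om r * ln (rowsum y r)) + t * (#|T|%:R * colsum y i).
  by rewrite [t * _]mulrCA -mulrDr ler_wpM2l.
have h6 : m * (t / (1 + t)) <= m * ln (1 + t) by rewrite ler_wpM2l.
have h7 : t * (#|T|%:R * colsum y i) <= t * (m - d) by rewrite ler_wpM2l // ltW.
have h8 : m * t - t * d / 2 <= m * (t / (1 + t)).
  have -> : m * (t / (1 + t)) = m * t - t * (m * t) / (1 + t) by field; lra.
  rewrite lerD2l lerN2 ler_pdivrMr; last lra.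
  have : t * (m * t) <= t * (d / 2) by rewrite ler_pM2l.
  have : 0 <= t * d / 2 * t by rewrite mulr_ge0 // ltW.
  lra.
lra.
Qed.

End Scaling.

(** * Trace against Frobenius norm for a matrix with a kernel *)

Section TraceRank.
Local Open Scope sesquilinear_scope.
Variable C : numClosedFieldType.

Lemma mxtrace_adjmul m n (X : 'M[C]_(m, n)) :
  \tr (X^t* *m X) = \sum_i \sum_j `|X i j| ^+ 2.
Proof.
rewrite /mxtrace exchange_big /=; apply: eq_bigr => j _.
by rewrite !mxE; apply: eq_bigr => i _; rewrite !mxE normCK mulrC.
Qed.

Lemma adjmxM m n p (A : 'M[C]_(m, n)) (B : 'M[C]_(n, p)) :
  (A *m B)^t* = B^t* *m A^t*.
Proof. by rewrite trmx_mul map_mxM. Qed.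

Lemma mxtrace_adj n (A : 'M[C]_n) : \tr (A^t*) = (\tr A)^*.
Proof. by rewrite -[LHS]/(\tr (map_mx Num.conj A^T)) trace_map_mx mxtrace_tr. Qed.

(** Cauchy-Schwarz between [N] and the orthogonal projection [P] that is annihilated by the
    orthonormalised rows of [K]: here [P *m N = N] and [P] has trace [n - d]. *)
Lemma trace_kernel_bound (d n : nat) (K : 'M[C]_(d, n)) (N : 'M[C]_n) :
  row_free K -> (d < n)%N -> K *m N = 0 ->
  `|\tr N| ^+ 2 <= (n - d)%:R * \sum_i \sum_j `|N i j| ^+ 2.
Proof.
move=> fK dn KN.
pose U := schmidt K.
have UU : U *m U^t* = 1%:M by apply/unitarymxP; rewrite schmidt_unitarymx // ltnW.
have UN : U *m N = 0.
  have : (U <= K)%MS by rewrite /U eqmx_schmidt_free.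
  by case/submxP => D ->; rewrite -mulmxA KN mulmx0.
pose P : 'M_n := 1%:M - U^t* *m U.
have PN : P *m N = N by rewrite mulmxBl mul1mx -mulmxA UN mulmx0 subr0.
have Pa : P^t* = P.
  rewrite /P linearB /= map_mxB -/(U^t*) trmx1 map_mx1.
  by rewrite -/((U^t* *m U)^t*) adjmxM trmxCK.
have PP : P *m P = P.
  rewrite {2}/P mulmxBr mulmx1 mulmxA {2}/P mulmxBl mul1mx -(mulmxA _ U) UU.
  by rewrite mulmx1 subrr mul0mx subr0.
have trP : \tr P = (n - d)%:R.
  by rewrite /P linearB /= mxtrace1 mxtrace_mulC UU mxtrace1 natrB // ltnW.
clearbody P; set c := \tr N; set k : C := (n - d)%:R.
have k0 : 0 < k by rewrite ltr0n subn_gt0.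
have kr : k^* = k by rewrite conj_Creal // ger0_real // ltW.
set S := \sum_i _.
have : 0 <= \tr ((k *: N - c *: P)^t* *m (k *: N - c *: P)).
  by rewrite mxtrace_adjmul; apply: sumr_ge0 => i _; apply: sumr_ge0 => j _; rewrite exprn_ge0.
have -> : (k *: N - c *: P)^t* = k *: N^t* - c^* *: P.
  rewrite linearB /= map_mxB !linearZ /= !map_mxZ /= -/(N^t*) -/(P^t*) Pa kr.
  by rewrite scalerN.
rewrite mulmxBl !mulmxBr -!scalemxAl -!scalemxAr PN PP.
have -> : N^t* *m P = N^t* by rewrite -{1}Pa -adjmxM PN.
rewrite !linearB /= !linearZ /= mxtrace_adj mxtrace_adjmul trP -/c -/S -/k.
rewrite normCK.
have -> : k * (k * S) - k * (c * c^*) - (c^* * (k * c) - c^* * (c * k)) =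
  k * (k * S - c * c^*) by ring.
by rewrite pmulr_rge0 // subr_ge0.
Qed.

End TraceRank.

(** * Real-valued squared modulus and the variance identity *)

Section Nsq.
Local Open Scope complex_scope.
Variable R : rcfType.

Definition nsq (z : R[i]) : R := complex.Re z ^+ 2 + complex.Im z ^+ 2.

Lemma nsq_ge0 z : 0 <= nsq z.
Proof. by rewrite addr_ge0 ?sqr_ge0. Qed.

Lemma nsqM x y : nsq (x * y) = nsq x * nsq y.
Proof. by case: x => a b; case: y => c d; rewrite /nsq /=; ring. Qed.

Lemma nsq_conj z : nsq (conjc z) = nsq z.
Proof. by case: z => a b; rewrite /nsq /=; ring. Qed.

Lemma nsqN z : nsq (- z) = nsq z.
Proof. by case: z => a b; rewrite /nsq /=; ring. Qed.

Lemma nsqR (x : R) : nsq x%:C = x ^+ 2.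
Proof. by rewrite /nsq /=; ring. Qed.

Lemma nsq_gt0 z : (0 < nsq z) = (z != 0).
Proof.
rewrite lt0r nsq_ge0 andbT /nsq paddr_eq0 ?sqr_ge0 // !sqrf_eq0.
by case: z => a b; rewrite eq_complex.
Qed.

Lemma nsqE z : (nsq z)%:C = z * conjc z.
Proof. by case: z => a b; rewrite /nsq; simpc; congr (_ +i* _) => /=; ring. Qed.

Lemma nsq_norm z : (nsq z)%:C = `|z| ^+ 2.
Proof. by rewrite add_Re2_Im2. Qed.

Lemma nsqD_le x y : nsq (x + y) <= 2 * nsq x + 2 * nsq y.
Proof.
case: x => a b; case: y => c d; rewrite /nsq /=.
have := sqr_ge0 (a - c); have := sqr_ge0 (b - d); nra.
Qed.

Lemma ReD (x y : R[i]) : complex.Re (x + y) = complex.Re x + complex.Re y.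
Proof. by case: x; case: y. Qed.

Lemma ImD (x y : R[i]) : complex.Im (x + y) = complex.Im x + complex.Im y.
Proof. by case: x; case: y. Qed.

Variable T : finType.

(** Lagrange's identity: the double sum is the exact defect in the Cauchy-Schwarz inequality. It is
    kept because part of the gain on rich lines comes from it. *)
Lemma real_variance (a x : T -> R) :
  (\sum_k a k * x k) ^+ 2 = (\sum_k a k) * (\sum_k a k * x k ^+ 2)
    - (\sum_k \sum_l a k * a l * (x k - x l) ^+ 2) / 2.
Proof.
have -> : \sum_k \sum_l a k * a l * (x k - x l) ^+ 2 =
    2 * ((\sum_k a k) * (\sum_k a k * x k ^+ 2)) - 2 * (\sum_k a k * x k) ^+ 2.
  transitivity (\sum_k ((a k * x k ^+ 2) * (\sum_l a l)
    + a k * (\sum_l a l * x l ^+ 2) - 2 * (a k * x k) * (\sum_l a l * x l))).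
    apply: eq_bigr => k _; rewrite !mulr_sumr -big_split -sumrB.
    by apply: eq_bigr => l _ /=; ring.
  by rewrite sumrB big_split /= -!mulr_suml -mulr_sumr; ring.
by field.
Qed.

Lemma nsq_variance (a : T -> R) (z : T -> R[i]) :
  nsq (\sum_k (a k)%:C * z k) = (\sum_k a k) * (\sum_k a k * nsq (z k))
    - (\sum_k \sum_l a k * a l * nsq (z k - z l)) / 2.
Proof.
rewrite /nsq (big_morph _ ReD (erefl : complex.Re 0 = 0)).
rewrite (big_morph _ ImD (erefl : complex.Im 0 = 0)).
rewrite (eq_bigr (fun k => a k * complex.Re (z k))); last first.
  by move=> k _; case: (z k) => c d /=; ring.
rewrite [X in _ + X ^+ 2](eq_bigr (fun k => a k * complex.Im (z k))); last first.
  by move=> k _; case: (z k) => c d /=; ring.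
rewrite !real_variance.
have -> : \sum_k a k * (complex.Re (z k) ^+ 2 + complex.Im (z k) ^+ 2) =
  \sum_k a k * complex.Re (z k) ^+ 2 + \sum_k a k * complex.Im (z k) ^+ 2.
  by rewrite -big_split; apply: eq_bigr => k _; rewrite mulrDr.
have -> : \sum_k \sum_l a k * a l *
    (complex.Re (z k - z l) ^+ 2 + complex.Im (z k - z l) ^+ 2) =
  \sum_k \sum_l a k * a l * (complex.Re (z k) - complex.Re (z l)) ^+ 2 +
  \sum_k \sum_l a k * a l * (complex.Im (z k) - complex.Im (z l)) ^+ 2.
  rewrite -big_split; apply: eq_bigr => k _.
  rewrite -big_split; apply: eq_bigr => l _ /=.
  by case: (z k) => ? ?; case: (z l) => ? ? /=; ring.
by field.
Qed.

End Nsq.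

(* [col i j k]: the points i, j, k are distinct and lie on a common line. *)
Record collinearity (T : eqType) (col : T -> T -> T -> bool) : Prop :=
  Collinearity {
    col_swap12 : forall i j k, col i j k = col j i k;
    col_swap23 : forall i j k, col i j k = col i k j;
    col_distinct : forall i j k, col i j k -> i != j;
    col_transitive : forall i j k l,
      col i j k -> col i j l -> k != l -> col i k l }.

(** * Weights on collinear triples and quadruples *)

Section Collinearity.
Variables (R : realType) (T : finType) (col : T -> T -> T -> bool).
Hypothesis hc : collinearity col.

Let colC12 := col_swap12 hc.
Let colC23 := col_swap23 hc.
Let col_neq := col_distinct hc.
Let col_trans := col_transitive hc.

(* The number of points of the line ij other than i and j. *)
Definition ell i j := (\sum_k col i j k)%N.

Lemma ellC i j : ell i j = ell j i.
Proof. by apply: eq_bigr => k _; rewrite colC12. Qed.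

Lemma col_ell_gt0 i j k : col i j k -> (0 < ell i j)%N.
Proof. by move=> h; rewrite /ell (bigD1 k) //= h. Qed.

Lemma col_neq13 i j k : col i j k -> i != k.
Proof. by rewrite colC23 => /col_neq. Qed.

Lemma col_neq23 i j k : col i j k -> j != k.
Proof. by rewrite colC12 => /col_neq13. Qed.

(** The third points of [i j] and of [i k] agree by transitivity, except that [k] is exchanged for
    [j]. *)
Lemma ell_line i j k : col i j k -> ell i j = ell i k.
Proof.
move=> h; rewrite /ell (bigD1 k) //=.
rewrite (bigD1 (P := predT) (F := fun l => nat_of_bool (col i k l)) j) //=.
rewrite h -colC23 h; congr (_ + _)%N.
rewrite big_mkcond [RHS]big_mkcond; apply: eq_bigr => l _ /=.
have [->|lk] /= := eqVneq l k.
  have [//|_] := eqVneq k j.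
  by case hk : (col i k k) => //; have := col_neq23 hk; rewrite eqxx.
have [->|lj] /= := eqVneq l j.
  by case hj : (col i j j) => //; have := col_neq23 hj; rewrite eqxx.
congr nat_of_bool; apply/idP/idP => h'.
  by apply: col_trans h h' _; rewrite eq_sym.
by rewrite colC23 in h; apply: col_trans h h' _; rewrite eq_sym.
Qed.

Lemma ell_gt0_neq i j : (0 < ell i j)%N -> i != j.
Proof.
rewrite lt0n; apply: contra_neqN => /eqP ->; rewrite /ell big1 // => k _.
by case h : (col j j k) => //; have := col_neq h; rewrite eqxx.
Qed.

(** This normalisation gives every ordered pair on a non-ordinary line total weight 1, and it is
    symmetric because [ell] is constant on a line. *)
Definition lweight i j k : R := (col i j k)%:R / (ell i j)%:R.

Lemma om_ge0 i j k : 0 <= lweight i j k.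
Proof. by rewrite divr_ge0. Qed.

Lemma om_gt0 i j k : (0 < lweight i j k) = col i j k.
Proof.
rewrite /lweight; case h : (col i j k); last by rewrite mul0r ltxx.
by rewrite divr_gt0 // ltr0n (col_ell_gt0 h).
Qed.

Lemma om_eq0 i j k : ~~ col i j k -> lweight i j k = 0.
Proof. by rewrite /lweight => /negbTE ->; rewrite mul0r. Qed.

Lemma omC12 i j k : lweight i j k = lweight j i k.
Proof. by rewrite /lweight colC12 ellC. Qed.

Lemma omC23 i j k : lweight i j k = lweight i k j.
Proof.
case h : (col i j k); last by rewrite !om_eq0 ?h // (colC23 i k j) h.
by rewrite /lweight (colC23 i k j) h (ell_line h).
Qed.

Lemma sum_om i j : \sum_k lweight i j k = (0 < ell i j)%N%:R.
Proof.
rewrite /lweight -mulr_suml -natr_sum -/(ell i j).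
case: (posnP (ell i j)) => [->|h]; first by rewrite mul0r.
by rewrite divff // pnatr_eq0 -lt0n.
Qed.

Definition wsum3 (F : T -> T -> T -> R) := \sum_i \sum_j \sum_k lweight i j k * F i j k.

Lemma S3C12 F : wsum3 F = wsum3 (fun i j k => F j i k).
Proof.
rewrite /wsum3 exchange_big; apply: eq_bigr => i _; apply: eq_bigr => j _.
by apply: eq_bigr => k _; rewrite omC12.
Qed.

Lemma S3C23 F : wsum3 F = wsum3 (fun i j k => F i k j).
Proof.
rewrite /wsum3; apply: eq_bigr => i _; rewrite exchange_big.
by apply: eq_bigr => k _; apply: eq_bigr => j _; rewrite omC23.
Qed.

Lemma S3D F G : wsum3 (fun i j k => F i j k + G i j k) = wsum3 F + wsum3 G.
Proof.
rewrite /wsum3 -big_split; apply: eq_bigr => i _; rewrite -big_split.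
apply: eq_bigr => j _; rewrite -big_split; apply: eq_bigr => k _.
exact: mulrDr.
Qed.

Lemma S3Z a F : wsum3 (fun i j k => a * F i j k) = a * wsum3 F.
Proof.
rewrite /wsum3 mulr_sumr; apply: eq_bigr => i _; rewrite mulr_sumr.
apply: eq_bigr => j _; rewrite mulr_sumr; apply: eq_bigr => k _.
exact: mulrCA.
Qed.

Lemma eq_S3 F G : (forall i j k, col i j k -> F i j k = G i j k) -> wsum3 F = wsum3 G.
Proof.
move=> FG; apply: eq_bigr => i _; apply: eq_bigr => j _; apply: eq_bigr => k _.
by case: (boolP (col i j k)) => h; [rewrite FG|rewrite om_eq0 // !mul0r].
Qed.

Lemma le_S3 F G : (forall i j k, col i j k -> F i j k <= G i j k) -> wsum3 F <= wsum3 G.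
Proof.
move=> FG; apply: ler_sum => i _; apply: ler_sum => j _; apply: ler_sum => k _.
case: (boolP (col i j k)) => h; last by rewrite om_eq0 // !mul0r.
by rewrite ler_wpM2l ?om_ge0 ?FG.
Qed.

Lemma S3_pair (G : T -> T -> R) :
  wsum3 (fun i j _ => G i j) = \sum_i \sum_j (0 < ell i j)%N%:R * G i j.
Proof.
apply: eq_bigr => i _; apply: eq_bigr => j _.
by rewrite -mulr_suml sum_om.
Qed.

(** Weight on quadruples of distinct collinear points, invariant under all permutations of the four,
    so that terms attached to different triples of a quadruple can be compared. *)
Definition om2 i j k l : R := lweight i j k * lweight i j l * (k != l)%:R.

Lemma om2_ge0 i j k l : 0 <= om2 i j k l.
Proof. by apply: mulr_ge0 => //; apply: mulr_ge0; exact: om_ge0. Qed.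

Lemma om2C12 i j k l : om2 i j k l = om2 j i k l.
Proof. by rewrite /om2 !(omC12 i j). Qed.

Lemma om2C34 i j k l : om2 i j k l = om2 i j l k.
Proof. by rewrite /om2 (eq_sym k l) (mulrC (lweight i j k)). Qed.

Lemma om2C23 i j k l : om2 i j k l = om2 i k j l.
Proof.
rewrite /om2 (omC23 i k j).
case: (boolP (col i j k)) => h; last by rewrite om_eq0 // !mul0r.
rewrite -[LHS](mulrA (lweight i j k)) -[RHS](mulrA (lweight i j k)); congr (_ * _).
rewrite /lweight -(ell_line h) mulrAC [RHS]mulrAC; congr (_ / _).
have h' : col i k j by rewrite -colC23.
rewrite -!natrM !mulnb; congr _%:R; congr nat_of_bool.
apply/andP/andP => -[h1 h2]; split.
- exact: col_trans h h1 h2.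
- exact: col_neq23 h1.
- exact: col_trans h' h1 h2.
- exact: col_neq23 h1.
Qed.

Definition wsum4 (F : T -> T -> T -> T -> R) :=
  \sum_i \sum_j \sum_k \sum_l om2 i j k l * F i j k l.

Lemma S4C12 F : wsum4 F = wsum4 (fun i j k l => F j i k l).
Proof.
rewrite /wsum4 exchange_big; apply: eq_bigr => i _; apply: eq_bigr => j _.
by apply: eq_bigr => k _; apply: eq_bigr => l _; rewrite om2C12.
Qed.

Lemma S4C23 F : wsum4 F = wsum4 (fun i j k l => F i k j l).
Proof.
rewrite /wsum4; apply: eq_bigr => i _; rewrite exchange_big; apply: eq_bigr => j _.
by apply: eq_bigr => k _; apply: eq_bigr => l _; rewrite om2C23.
Qed.

Lemma S4C34 F : wsum4 F = wsum4 (fun i j k l => F i j l k).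
Proof.
rewrite /wsum4; apply: eq_bigr => i _; apply: eq_bigr => j _; rewrite exchange_big.
by apply: eq_bigr => k _; apply: eq_bigr => l _; rewrite om2C34.
Qed.

Lemma S4D F G : wsum4 (fun i j k l => F i j k l + G i j k l) = wsum4 F + wsum4 G.
Proof.
rewrite /wsum4 -big_split; apply: eq_bigr => i _; rewrite -big_split.
apply: eq_bigr => j _; rewrite -big_split; apply: eq_bigr => k _.
by rewrite -big_split; apply: eq_bigr => l _; exact: mulrDr.
Qed.

Lemma le_S4 F G :
  (forall i j k l, col i j k -> col i j l -> k != l -> F i j k l <= G i j k l) ->
  wsum4 F <= wsum4 G.
Proof.
move=> FG; apply: ler_sum => i _; apply: ler_sum => j _; apply: ler_sum => k _.
apply: ler_sum => l _.
case: (boolP (col i j k)) => h; last by rewrite /om2 om_eq0 // !mul0r.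
case: (boolP (col i j l)) => h'; last by rewrite /om2 [lweight i j l]om_eq0 // mulr0 !mul0r.
case: (boolP (k != l)) => kl; last by rewrite /om2 (negbTE kl) mulr0 !mul0r.
by rewrite ler_wpM2l ?om2_ge0 ?FG.
Qed.

(** Once [i], [j], [k] are fixed, the weights of the fourth point sum to at most 1. *)
Lemma S4_le_S3 (F : T -> T -> T -> R) : (forall i j k, 0 <= F i j k) ->
  wsum4 (fun i j k _ => F i j k) <= wsum3 F.
Proof.
move=> F0; apply: ler_sum => i _; apply: ler_sum => j _; apply: ler_sum => k _.
rewrite -mulr_suml ler_wpM2r // /om2.
have h l : lweight i j k * lweight i j l * (k != l)%:R <= lweight i j k * lweight i j l.
  by rewrite ler_piMr ?lern1 ?leq_b1 //; apply: mulr_ge0; exact: om_ge0.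
apply: (le_trans (ler_sum _ (fun l _ => h l))).
by rewrite -mulr_sumr sum_om ler_piMr ?om_ge0 // lern1 leq_b1.
Qed.

(** Ordered pairs whose line carries at least four points. *)
Definition rich_pairs := (\sum_i \sum_j (1 < ell i j))%N.

(** Two independent third points of [i j] coincide with probability [1 / ell i j], which is at most
    1/2 on a rich line. *)
Lemma S4_const_ge (c : R) : 0 <= c -> c / 2 * rich_pairs%:R <= wsum4 (fun _ _ _ _ => c).
Proof.
move=> c0; rewrite /wsum4 /rich_pairs natr_sum mulr_sumr; apply: ler_sum => i _.
rewrite natr_sum mulr_sumr; apply: ler_sum => j _.
case: (ltnP 1 (ell i j)) => [h|h]; last first.
  by rewrite mulr0 sumr_ge0 // => k _; rewrite sumr_ge0 // => l _; rewrite mulr_ge0 ?om2_ge0.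
rewrite mulr1.
have -> : \sum_k \sum_l om2 i j k l * c = c * (1 - \sum_k lweight i j k ^+ 2).
  have -> : 1 = (\sum_k lweight i j k) * (\sum_l lweight i j l) by rewrite !sum_om ltnW // mulr1.
  rewrite mulr_suml -sumrB mulr_sumr; apply: eq_bigr => k _.
  rewrite -mulr_suml mulrC; congr (_ * _).
  rewrite mulr_sumr (bigD1 k) //= [in RHS](bigD1 k) //= /om2 eqxx mulr0 add0r.
  rewrite expr2 addrAC subrr add0r.
  by apply: eq_bigr => l lk; rewrite eq_sym lk mulr1.
have e0 : 0 < (ell i j)%:R :> R by rewrite ltr0n ltnW.
have -> : \sum_k lweight i j k ^+ 2 = (ell i j)%:R^-1.
  transitivity (\sum_k lweight i j k * (ell i j)%:R^-1); last first.
    by rewrite -mulr_suml sum_om ltnW // mul1r.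
  apply: eq_bigr => k _; rewrite /lweight expr2; case: (col i j k); last by rewrite !mul0r.
  by rewrite mul1r.
have : (ell i j)%:R^-1 <= 2^-1 :> R by rewrite lef_pV2 ?posrE // ler_nat.
nra.
Qed.

End Collinearity.

(** * Elementary inequalities behind the gap for four collinear points *)

Lemma sqr_close_third (R : realFieldType) (x : R) :
  (x - 1 / 3) ^+ 2 < 1 / 900 -> 3 / 10 < x < 4 / 10.
Proof. by move=> hx; apply/andP; split; nra. Qed.

(** If the bound failed, [a], [a'], [b], [c], [d] would all lie between 3/10 and 4/10. The product
    formula then makes [X * d] at least [(3 / 10) ^ 5 = 0.00243], while the upper bound on [X] keeps
    it below 0.0024. *)
Lemma quadruple_arith (R : realFieldType) (a a' b c d a2 a3 u v X : R) :
  0 <= v -> 0 <= u -> 0 <= X -> 0 < a' -> 0 < a3 ->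
  X * d = a * a' ^+ 2 * b * c ->
  X <= 2 * (v * a' ^+ 2) + 2 * (u * (a' - a) ^+ 2) ->
  u = a' * a2 -> a' + a2 + a3 = 1 ->
  1 / 900 <= (b - 1 / 3) ^+ 2 + (c - 1 / 3) ^+ 2 + (a - 1 / 3) ^+ 2
    + (d - 1 / 3) ^+ 2 + (a' - 1 / 3) ^+ 2 + v.
Proof.
move=> v0 u0 X0 a'0 a30 hX hb zz qs; rewrite leNgt; apply/negP => H.
have := sqr_ge0 (b - 1 / 3); have := sqr_ge0 (c - 1 / 3).
have := sqr_ge0 (a - 1 / 3); have := sqr_ge0 (d - 1 / 3).
have := sqr_ge0 (a' - 1 / 3) => s1 s2 s3 s4 s5.
have /andP[b1 b2] : 3 / 10 < b < 4 / 10 by apply: sqr_close_third; lra.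
have /andP[c1 c2] : 3 / 10 < c < 4 / 10 by apply: sqr_close_third; lra.
have /andP[a1 a4] : 3 / 10 < a < 4 / 10 by apply: sqr_close_third; lra.
have /andP[d1 d2] : 3 / 10 < d < 4 / 10 by apply: sqr_close_third; lra.
have /andP[a5 a6] : 3 / 10 < a' < 4 / 10 by apply: sqr_close_third; lra.
have hv : v <= 1 / 900 by lra.
move: hX hb {H s1 s2 s3 s4 s5} => hX hb.
have hu : u <= 4 / 10 * (7 / 10).
  rewrite zz; apply: (@le_trans _ _ (a' * (7 / 10))).
    by rewrite ler_pM2l //; lra.
  by rewrite ler_pM2r; lra.
move: {zz qs} hX hb.
have sa : a' ^+ 2 <= (4 / 10) ^+ 2 by rewrite ler_sqr ?nnegrE; move: a5 a6; clear; lra.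
have sa1 : (3 / 10) ^+ 2 <= a' ^+ 2 by rewrite ler_sqr ?nnegrE; move: a5 a6; clear; lra.
have sd : (a' - a) ^+ 2 <= (1 / 10) ^+ 2.
  by rewrite -subr_ge0 subr_sqr mulr_ge0; move: a5 a6 a1 a4; clear; lra.
have h1 : v * a' ^+ 2 <= 1 / 900 * (4 / 10) ^+ 2 by rewrite ler_pM ?sqr_ge0.
have h2 : u * (a' - a) ^+ 2 <= 4 / 10 * (7 / 10) * (1 / 10) ^+ 2.
  by rewrite ler_pM ?sqr_ge0.
have t0 : 0 <= 3 / 10 :> R by clear; lra.
have t1 : 0 <= 3 / 10 * (3 / 10) ^+ 2 :> R by clear; lra.
have t2 : 0 <= 3 / 10 * (3 / 10) ^+ 2 * (3 / 10) :> R by clear; lra.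
have h5 : 3 / 10 * (3 / 10) ^+ 2 <= a * a' ^+ 2.
  by rewrite ler_pM ?sqr_ge0 ?t0 // ltW.
have h6 : 3 / 10 * (3 / 10) ^+ 2 * (3 / 10) <= a * a' ^+ 2 * b.
  by apply: ler_pM => //; exact: ltW.
have h7 : 3 / 10 * (3 / 10) ^+ 2 * (3 / 10) * (3 / 10) <= a * a' ^+ 2 * b * c.
  by apply: ler_pM => //; exact: ltW.
move=> hX hb; move: h7; rewrite -hX => h7.
have h3 : X <= 2 * (1 / 900 * (4 / 10) ^+ 2) + 2 * (4 / 10 * (7 / 10) * (1 / 10) ^+ 2).
  by move: h1 h2 hb; clear; lra.
have h4 : X * d <= (2 * (1 / 900 * (4 / 10) ^+ 2)
    + 2 * (4 / 10 * (7 / 10) * (1 / 10) ^+ 2)) * (4 / 10).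
  by apply: ler_pM => //; move: d1 d2; clear; lra.
by move: h4 h7; clear; lra.
Qed.

(** * Entries of the scaled dependency matrix *)

Section Design.
Local Open Scope complex_scope.
Variables (R : realType) (T : finType) (col : T -> T -> T -> bool).
Hypothesis hc : collinearity col.
Variables (f : T -> R[i]) (y : T -> R).
Hypothesis f_inj : injective f.
Hypothesis y_gt0 : forall i, 0 < y i.

Local Notation S3 := (wsum3 (R := R) col).
Local Notation S4 := (wsum4 (R := R) col).
Local Notation om := (lweight R col).
Local Notation ell := (ell col).

Definition sqdist j k := nsq (f j - f k).

Lemma wC j k : sqdist j k = sqdist k j.
Proof. by rewrite /sqdist -nsqN opprB. Qed.

Lemma w_gt0 j k : j != k -> 0 < sqdist j k.
Proof. by move=> jk; rewrite nsq_gt0 subr_eq0 (inj_eq f_inj). Qed.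

(** Squared norm of the dependency of the triple once its columns are scaled by the square roots of
    [y]. *)
Definition rowN i j k := sqdist j k * y i + sqdist k i * y j + sqdist i j * y k.

Lemma rowN_C12 i j k : rowN i j k = rowN j i k.
Proof. by rewrite /rowN (wC i j) (wC k i) (wC j k); ring. Qed.

Lemma rowN_C23 i j k : rowN i j k = rowN i k j.
Proof. by rewrite /rowN (wC i j) (wC k i) (wC j k); ring. Qed.

Lemma rowN_gt0 i j k : col i j k -> 0 < rowN i j k.
Proof.
move=> h; have h1 := col_distinct hc h; have h2 := col_neq13 hc h.
have h3 := col_neq23 hc h; rewrite eq_sym in h2.
by rewrite /rowN !addr_gt0 // mulr_gt0 // w_gt0.
Qed.

(* Scale column i of the dependency matrix by sqrt (y i) and normalise the row of
   the triple ijk: then [share i j k] is the squared modulus of its i-th entry and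
   [cross i j k] is its conjugated i-th entry times its j-th entry. *)
Definition share i j k := sqdist j k * y i / rowN i j k.

Lemma q_C23 i j k : share i j k = share i k j.
Proof. by rewrite /share wC rowN_C23. Qed.

Lemma q_gt0 i j k : col i j k -> 0 < share i j k.
Proof.
move=> h; rewrite divr_gt0 ?rowN_gt0 // mulr_gt0 // w_gt0 //.
exact: (col_neq23 hc h).
Qed.

Lemma q_sum i j k : col i j k -> share i j k + share j i k + share k i j = 1.
Proof.
move=> h; have N0 := rowN_gt0 h.
rewrite /share -(rowN_C12 i j) -(rowN_C12 i k) -(rowN_C23 i j) (wC i k) -!mulrDl divff //.
by rewrite gt_eqF.
Qed.

Definition cross i j k : R[i] :=
  conjc (f j - f k) * (f k - f i) * (Num.sqrt (y i) * Num.sqrt (y j) / rowN i j k)%:C.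

Lemma nsq_z i j k : nsq (cross i j k) = share i j k * share j i k.
Proof.
rewrite /cross !nsqM nsqR nsq_conj -/(sqdist j k) -/(sqdist k i) /share -(rowN_C12 i j) (wC i k).
rewrite !exprMn !sqr_sqrtr ?(ltW (y_gt0 _)) // exprVn.
rewrite expr2 invfM; ring.
Qed.

(* The triples ijk and ijl give different ratios of the coefficients of i and j;
   by the three-term Pluecker relation the gap is computed by the weights. *)
Lemma nsq_z_gap i j k l : col i j k -> col i j l -> k != l ->
  nsq (cross i j k * (share i j l)%:C - cross i j l * (share i j k)%:C) * share k j l =
  share i j k * share i j l ^+ 2 * share k i j * share j k l.
Proof.
move=> hk hl kl.
have hkl : col k j l.
  rewrite (col_swap12 hc); apply: (col_transitive hc) _ _ kl.
    by rewrite (col_swap12 hc); exact: hk.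
  by rewrite (col_swap12 hc).
have N1 := rowN_gt0 hk; have N2 := rowN_gt0 hl; have N3 := rowN_gt0 hkl.
pose s := Num.sqrt (y i) * Num.sqrt (y j).
(* With the common conjugates factored out this is [(f k - f i) * (f j - f l) - (f l - f i) * (f j -
   f k) = (f k - f l) * (f j - f i)]. *)
have -> : cross i j k * (share i j l)%:C - cross i j l * (share i j k)%:C =
  conjc (f j - f k) * conjc (f j - f l) * (f k - f l) * (f j - f i) *
  (s * y i / (rowN i j k * rowN i j l))%:C.
  rewrite /cross /share -/s.
  have -> : (sqdist j l * y i / rowN i j l)%:C =
     (f j - f l) * conjc (f j - f l) * (y i / rowN i j l)%:C.
    by rewrite -mulrA rmorphM /= nsqE.
  have -> : (sqdist j k * y i / rowN i j k)%:C =
     (f j - f k) * conjc (f j - f k) * (y i / rowN i j k)%:C.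
    by rewrite -mulrA rmorphM /= nsqE.
  have -> : s * y i / (rowN i j k * rowN i j l) =
     (s / rowN i j k) * (y i / rowN i j l) by rewrite invfM; ring.
  rewrite !rmorphM /=.
  by set a := conjc _; set b := conjc _; ring.
rewrite !nsqM !nsq_conj nsqR -/(sqdist j k) -/(sqdist j l) -/(sqdist k l) -/(sqdist j i) /share.
rewrite !exprMn !sqr_sqrtr ?(ltW (y_gt0 _)) // -(rowN_C12 k j).
rewrite -(rowN_C12 i k) -(rowN_C23 i j) !exprVn !exprMn.
rewrite (wC i j).
have w0 : sqdist j l != 0 by rewrite gt_eqF // w_gt0 // (col_neq23 hc hl).
have := y_gt0 k.
move: N1 N2 N3; set n1 := rowN i j k; set n2 := rowN i j l; set n3 := rowN k j l.
move=> N1 N2 N3 yk.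
by field; rewrite !gt_eqF.
Qed.

Definition qdev i j k := (share i j k - 1 / 3) ^+ 2.

Lemma quadruple_gap i j k l : col i j k -> col i j l -> k != l ->
  1 / 900 <= qdev k i j + qdev j k l + qdev i j k + qdev k j l + qdev i j l
             + nsq (cross i j k - cross i j l).
Proof.
move=> hk hl kl.
have hX := nsq_z_gap hk hl kl.
have hkl : col k j l.
  rewrite (col_swap12 hc); apply: (col_transitive hc) _ _ kl.
    by rewrite (col_swap12 hc); exact: hk.
  by rewrite (col_swap12 hc).
have qs := q_sum hl.
have zz := nsq_z i j l.
(* If both the cross terms and the shares of [k] and [l] were close, the left-hand side of
   [nsq_z_gap] would be small. *)
have hb : nsq (cross i j k * (share i j l)%:C - cross i j l * (share i j k)%:C) <=
    2 * (nsq (cross i j k - cross i j l) * share i j l ^+ 2) +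
    2 * (nsq (cross i j l) * (share i j l - share i j k) ^+ 2).
  have -> : cross i j k * (share i j l)%:C - cross i j l * (share i j k)%:C =
     (cross i j k - cross i j l) * (share i j l)%:C + cross i j l * (share i j l - share i j k)%:C.
    by rewrite rmorphB /=; ring.
  by apply: le_trans (nsqD_le _ _) _; rewrite !nsqM !nsqR.
have hl' : col l i j by rewrite (col_swap12 hc) (col_swap23 hc).
exact: (quadruple_arith (nsq_ge0 _) (nsq_ge0 _) (nsq_ge0 _) (q_gt0 hl) (q_gt0 hl')
  hX hb zz qs).
Qed.

End Design.

Lemma sum_enum_val (T : finType) (V : nmodType) (F : T -> V) :
  \sum_i F i = \sum_(s < #|T|) F (enum_val s).
Proof. by apply: reindex; exact/onW_bij/enum_val_bij. Qed.

(** * The Gram matrix: trace, Frobenius norm and kernel *)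

Section DesignMatrix.
Local Open Scope complex_scope.
Variables (R : realType) (T : finType) (col : T -> T -> T -> bool).
Hypothesis hc : collinearity col.
Variables (f : T -> R[i]) (y : T -> R).
Hypothesis f_inj : injective f.
Hypothesis y_gt0 : forall i, 0 < y i.

Local Notation S3 := (wsum3 (R := R) col).
Local Notation S4 := (wsum4 (R := R) col).
Local Notation om := (lweight R col).
Local Notation ell := (ell col).
Local Notation w := (sqdist f).
Local Notation q := (share f y).
Local Notation z := (cross f y).
Local Notation qdev := (qdev f y).
Local Notation rowN := (rowN f y).

Definition total_weight := S3 (fun _ _ _ => 1).
Definition deviation := S3 qdev.
(** For each pair this is twice the variance of [z i j k] over the third point, since the weights of
    a pair sum to 1 or all vanish. *)
Definition variance := \sum_i \sum_j \sum_k \sum_l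
  om i j k * om i j l * nsq (z i j k - z i j l).

(** [quadruple_gap] is summed with the weights [om2]; by symmetry each of its five [qdev] terms
    contributes at most [deviation]. The factor 1/2 comes from [S4_const_ge]. *)
Lemma gain_lower_bound :
  1 / 1800 * (rich_pairs col)%:R <= 5 * deviation + variance.
Proof.
have c0 : 0 <= 1 / 900 :> R by lra.
have := S4_const_ge col c0.
have : S4 (fun _ _ _ _ => 1 / 900) <= S4 (fun i j k l => qdev k i j + qdev j k l
    + qdev i j k + qdev k j l + qdev i j l + nsq (z i j k - z i j l)).
  by apply: le_S4 => i j k l; exact: quadruple_gap.
rewrite 5!S4D.
have dev : S4 (fun i j k _ => qdev i j k) <= deviation.
  by apply: S4_le_S3 => i j k; exact: sqr_ge0.
have h1 : S4 (fun i j k _ => qdev k i j) <= deviation.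
  apply: (@le_trans _ _ (S3 (fun i j k => qdev k i j))).
    by apply: S4_le_S3 => i j k; exact: sqr_ge0.
  by rewrite (S3C23 hc) (S3C12 hc).
have h2 : S4 (fun i j k l => qdev j k l) <= deviation.
  by rewrite (S4C12 hc) (S4C23 hc) S4C34.
have h3 : S4 (fun i j k l => qdev k j l) <= deviation.
  by rewrite (S4C12 hc) (S4C23 hc) (S4C12 hc) S4C34.
have h4 : S4 (fun i j _ l => qdev i j l) <= deviation by rewrite S4C34.
have h5 : S4 (fun i j k l => nsq (z i j k - z i j l)) <= variance.
  apply: ler_sum => i _; apply: ler_sum => j _; apply: ler_sum => k _.
  apply: ler_sum => l _; rewrite ler_wpM2r ?nsq_ge0 // /om2.
  rewrite ler_piMr ?lern1 ?leq_b1 //; apply: mulr_ge0; exact: om_ge0.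
lra.
Qed.

Definition diag i := \sum_j \sum_k om i j k * q i j k.

Lemma S3_q : S3 q = total_weight / 3.
Proof.
have e : S3 (fun i j k => q i j k + q j i k + q k i j) = total_weight.
  by apply: eq_S3 => i j k h; rewrite (q_sum hc f_inj y_gt0 h).
move: e; rewrite !S3D -(S3C12 hc q).
have -> : S3 (fun i j k => q k i j) = S3 q by rewrite (S3C23 hc) -(S3C12 hc q).
lra.
Qed.

(** Squaring [q i j k + q j i k + q k i j = 1] trades products for squares, and [S3] of the squares
    exceeds [total_weight / 9] by [deviation]. *)
Lemma S3_qq : S3 (fun i j k => q i j k * q j i k) = total_weight / 9 - deviation / 2.
Proof.
have e1 : S3 (fun i j k => q i j k * q j i k + q j i k * q k i j + q i j k * q k i j)
   = S3 (fun i j k => 1 / 2 * 1 + (- 1 / 2) * (q i j k ^+ 2 + q j i k ^+ 2 + q k i j ^+ 2)).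
  apply: eq_S3 => i j k h; have e := q_sum hc f_inj y_gt0 h.
  have -> : q k i j = 1 - q i j k - q j i k by lra.
  by field.
have e2 : S3 (fun i j k => q j i k * q k i j) = S3 (fun i j k => q i j k * q j i k).
  rewrite (S3C12 hc) (S3C23 hc); apply: eq_S3 => i j k _.
  by rewrite (q_C23 f y i k j) (q_C23 f y j k i).
have e3 : S3 (fun i j k => q i j k * q k i j) = S3 (fun i j k => q i j k * q j i k).
  rewrite (S3C23 hc); apply: eq_S3 => i j k _.
  by rewrite (q_C23 f y i k j).
have e4 : S3 (fun i j k => q j i k ^+ 2) = S3 (fun i j k => q i j k ^+ 2).
  by rewrite (S3C12 hc).
have e5 : S3 (fun i j k => q k i j ^+ 2) = S3 (fun i j k => q i j k ^+ 2).
  by rewrite (S3C23 hc) e4.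
have e6 : deviation = S3 (fun i j k => q i j k ^+ 2 + (- 2 / 3) * q i j k + 1 / 9 * 1).
  by apply: eq_S3 => i j k _; rewrite /qdev; field.
move: e1 e6; rewrite !(S3D, S3Z) e2 e3 e4 e5 -/total_weight S3_q; lra.
Qed.

(* The Gram matrix of the scaled dependencies; each pair of entries occurs twice
   because the triples are ordered. *)
Definition gram i j : R[i] :=
  2 * (\sum_k (om i j k)%:C * z i j k) + (i == j)%:R * (diag i)%:C.

Lemma om_diag i k : om i i k = 0.
Proof. by apply: om_eq0; apply/negP => /(col_distinct hc); rewrite eqxx. Qed.

Lemma gram_diag i : gram i i = (diag i)%:C.
Proof.
rewrite /gram eqxx mul1r big1 ?mulr0 ?add0r // => k _.
by rewrite om_diag mul0r.
Qed.

Lemma nsq_gram i j : nsq (gram i j) = (i == j)%:R * diag i ^+ 2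
  + 4 * (\sum_k om i j k * (q i j k * q j i k)
         - (\sum_k \sum_l om i j k * om i j l * nsq (z i j k - z i j l)) / 2).
Proof.
have [<-|ij] := eqVneq i j.
  rewrite gram_diag nsqR mul1r !big1 ?mul0r ?subrr ?mulr0 ?addr0 //.
    by move=> k _; rewrite big1 // => l _; rewrite om_diag !mul0r.
  by move=> k _; rewrite om_diag mul0r.
rewrite /gram (negbTE ij) !mul0r addr0 add0r nsqM nsq_variance.
have -> : nsq (2 : R[i]) = 4 by rewrite -(rmorph_nat (real_complex R) 2) nsqR; ring.
congr (_ * (_ - _)).
have -> : \sum_k om i j k * nsq (z i j k) = \sum_k om i j k * (q i j k * q j i k).
  by apply: eq_bigr => k _; rewrite nsq_z.
(* For an ordinary pair the total weight is 0 instead of 1, but then every term vanishes too. *)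
rewrite sum_om; case: posnP => [e|_]; last by rewrite mul1r.
rewrite mul0r big1 // => k _; rewrite om_eq0 ?mul0r //.
by apply/negP => /(@col_ell_gt0 _ _ _ _ _); rewrite e.
Qed.

Lemma frobenius_gram : \sum_i \sum_j nsq (gram i j) =
  \sum_i diag i ^+ 2 + 4 / 9 * total_weight - 2 * deviation - 2 * variance.
Proof.
have -> : \sum_i \sum_j nsq (gram i j) = \sum_i (diag i ^+ 2
  + 4 * (\sum_j \sum_k om i j k * (q i j k * q j i k))
  - 2 * (\sum_j \sum_k \sum_l om i j k * om i j l * nsq (z i j k - z i j l))).
  apply: eq_bigr => i _; rewrite (eq_bigr _ (fun j _ => nsq_gram i j)).
  rewrite big_split /=; rewrite -addrA; congr (_ + _).
    rewrite (bigD1 i) //= eqxx mul1r big1 ?addr0 // => j ji.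
    by rewrite eq_sym (negbTE ji) mul0r.
  by rewrite -mulr_sumr sumrB -mulr_suml; field.
rewrite sumrB big_split /= -!mulr_sumr -/variance.
have := S3_qq; rewrite {1}/wsum3 => ->; by field.
Qed.

Lemma gram_kernel (g : T -> R[i]) :
  (forall i j k, col i j k ->
     (f j - f k) * g i + (f k - f i) * g j + (f i - f j) * g k = 0) ->
  forall i, \sum_j gram i j * (g j / (Num.sqrt (y j))%:C) = 0.
Proof.
move=> dep i.
have s0 j : (Num.sqrt (y j))%:C != 0 :> R[i].
  by rewrite fmorph_eq0 sqrtr_eq0 -ltNge.
(* Antisymmetry of [c] turns one of the two copies of the [g j] term into the [g k] term, which
   completes the dependency of the triple. *)
pose c j k : R[i] := (om i j k)%:C * conjc (f j - f k) *
   (Num.sqrt (y i) / rowN i j k)%:C.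
have cC j k : c j k = - c k j.
  rewrite /c (omC23 R hc i k j) (rowN_C23 f y i k j) -[f k - f j]opprB rmorphN /=.
  ring.
have e1 : \sum_j gram i j * (g j / (Num.sqrt (y j))%:C) =
   2 * (\sum_j \sum_k c j k * ((f k - f i) * g j)) +
   \sum_j \sum_k c j k * ((f j - f k) * g i).
  rewrite mulr_sumr.
  have -> : \sum_j \sum_k c j k * ((f j - f k) * g i) =
     \sum_j ((i == j)%:R * (diag i)%:C) * (g j / (Num.sqrt (y j))%:C).
    rewrite [RHS](bigD1 i) //= eqxx mul1r [X in _ = _ + X]big1 ?addr0; last first.
      by move=> j ji; rewrite eq_sym (negbTE ji) !mul0r.
    rewrite /diag rmorph_sum mulr_suml; apply: eq_bigr => j _.
    rewrite rmorph_sum mulr_suml; apply: eq_bigr => k _.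
    rewrite /c /share.
    have yi : y i = Num.sqrt (y i) ^+ 2 by rewrite sqr_sqrtr // ltW.
    have -> : om i j k * (w j k * y i / rowN i j k) =
      om i j k * w j k * (Num.sqrt (y i) / rowN i j k) * Num.sqrt (y i).
      by rewrite {1}yi; ring.
    rewrite [in RHS]rmorphM /= [in RHS]rmorphM /= (rmorphM _ (om i j k)) /= nsqE.
    move: (conjc _) ((om i j k)%:C) ((Num.sqrt (y i) / rowN i j k)%:C)
      ((Num.sqrt (y i))%:C) (s0 i) => a o b s hs.
    by field.
  rewrite -big_split /=; apply: eq_bigr => j _.
  rewrite /gram mulrDl; congr (_ + _).
  rewrite -mulrA; congr (_ * _); rewrite mulr_suml; apply: eq_bigr => k _.
  rewrite /c /cross.
  have -> : Num.sqrt (y i) * Num.sqrt (y j) / rowN i j k =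
     (Num.sqrt (y i) / rowN i j k) * Num.sqrt (y j) by ring.
  rewrite (rmorphM _ (Num.sqrt (y i) / rowN i j k)) /=.
  move: (conjc _) ((om i j k)%:C) ((Num.sqrt (y i) / rowN i j k)%:C)
    ((Num.sqrt (y j))%:C) (s0 j) => a o b s hs.
  by field.
rewrite e1.
have e2 : \sum_j \sum_k c j k * ((f k - f i) * g j) =
   \sum_j \sum_k c j k * ((f i - f j) * g k).
  rewrite exchange_big; apply: eq_bigr => j _; apply: eq_bigr => k _.
  by rewrite cC; ring.
rewrite mulr_natl mulr2n {2}e2 -!big_split /= big1 // => j _.
rewrite -!big_split /= big1 // => k _.
rewrite -!mulrDr.
case: (boolP (col i j k)) => h; last by rewrite /c om_eq0 // !mul0r.
have -> : (f k - f i) * g j + (f i - f j) * g k + (f j - f k) * g i = 0.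
  by rewrite -(dep _ _ _ h); ring.
by rewrite mulr0.
Qed.

(** The vectors with entries [g a j / sqrt (y j)] are independent and lie in the kernel of the Gram
    matrix, so [trace_kernel_bound] applies. [N] is the transpose because [K] multiplies from the
    left. *)
Lemma trace_bound (d : nat) (g : 'I_d -> T -> R[i]) :
  (d < #|T|)%N ->
  (forall a i j k, col i j k ->
     (f j - f k) * g a i + (f k - f i) * g a j + (f i - f j) * g a k = 0) ->
  (forall c : 'I_d -> R[i], (forall i, \sum_a c a * g a i = 0) -> forall a, c a = 0) ->
  (\sum_i diag i) ^+ 2 <= (#|T| - d)%:R * \sum_i \sum_j nsq (gram i j).
Proof.
move=> dn dep free.
have s0 j : (Num.sqrt (y j))%:C != 0 :> R[i].
  by rewrite fmorph_eq0 sqrtr_eq0 -ltNge.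
pose K : 'M[R[i]]_(d, #|T|) :=
  \matrix_(a, s) (g a (enum_val s) / (Num.sqrt (y (enum_val s)))%:C).
pose N : 'M[R[i]]_#|T| := \matrix_(s, t) gram (enum_val t) (enum_val s).
have fK : row_free K.
  apply/row_freeP; apply/row_freeP; rewrite -kermx_eq0.
  apply/eqP/row_matrixP => r; rewrite row0.
  set v := row r _.
  have vK : v *m K = 0 by rewrite /v -row_mul mulmx_ker row0.
  apply/rowP => a; rewrite [RHS]mxE; apply: (free (fun a => v 0 a)) => i.
  have /rowP /(_ (enum_rank i)) := vK; rewrite !mxE.
  rewrite (eq_bigr (fun a => v 0 a * g a i * (Num.sqrt (y i))%:C^-1)); last first.
    by move=> b _; rewrite !mxE enum_rankK mulrA.
  rewrite -mulr_suml => /eqP; rewrite mulf_eq0 invr_eq0 (negbTE (s0 i)) orbF.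
  by move/eqP.
have KN : K *m N = 0.
  apply/matrixP => a t; rewrite !mxE.
  rewrite -[RHS](gram_kernel (dep a) (enum_val t)) [RHS]sum_enum_val /=.
  by apply: eq_bigr => s _; rewrite !mxE mulrC.
have := trace_kernel_bound fK dn KN.
have -> : \tr N = (\sum_i diag i)%:C.
  rewrite rmorph_sum /mxtrace [RHS]sum_enum_val /=.
  by apply: eq_bigr => s _; rewrite mxE gram_diag.
have -> : \sum_i \sum_j `|N i j| ^+ 2 = (\sum_i \sum_j nsq (gram i j))%:C.
  rewrite exchange_big rmorph_sum [RHS]sum_enum_val /=.
  apply: eq_bigr => s _; rewrite rmorph_sum [RHS]sum_enum_val /=.
  by apply: eq_bigr => t _; rewrite mxE nsq_norm.
rewrite -nsq_norm nsqR -[(#|T| - d)%:R](rmorph_nat (real_complex R)) -rmorphM.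
by rewrite /= lecR.
Qed.

End DesignMatrix.

(** * Lower bound for ordinary pairs when no point is heavy *)

Section AbstractBound.
Local Open Scope complex_scope.
Variables (R : realType) (T : finType) (col : T -> T -> T -> bool).
Hypothesis hc : collinearity col.
Variable f : T -> R[i].
Hypothesis f_inj : injective f.

Local Notation S3 := (wsum3 (R := R) col).
Local Notation om := (lweight R col).
Local Notation ell := (ell col).
Local Notation n := #|T|.

Definition ordinary i j := (i != j) && (ell i j == 0)%N.
Definition ordinary_degree i := (\sum_j ordinary i j)%N.
(** Pairs are ordered, so this is twice the number of ordinary lines. *)
Definition ordinary_pairs := (\sum_i ordinary_degree i)%N.

Lemma special_ordinary i j :
  (0 < ell i j)%N%:R = (i != j)%:R - (ordinary i j)%:R :> R.
Proof.
rewrite /ordinary lt0n; have := @ell_gt0_neq _ _ hc i j; rewrite lt0n.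
by case: (ell i j == 0)%N => /= [_|->//]; rewrite ?andbT ?subrr ?andbF ?subr0.
Qed.

Lemma sum_const (c : R) : \sum_(i : T) c = n%:R * c.
Proof. by rewrite sumr_const mulr_natl. Qed.

Lemma sum_neq (i : T) : \sum_j (i != j)%:R = n%:R - 1 :> R.
Proof.
rewrite (bigD1 i) //= eqxx add0r (eq_bigr (fun=> 1)) => [|j].
  by rewrite sumr_const cardC1 -subn1 natrB //; apply/card_gt0P; exists i.
by rewrite eq_sym => ->.
Qed.

Lemma special_degree i :
  \sum_j (0 < ell i j)%N%:R = n%:R - 1 - (ordinary_degree i)%:R :> R.
Proof.
rewrite (eq_bigr _ (fun j _ => special_ordinary i j)) sumrB sum_neq.
by rewrite natr_sum.
Qed.

Lemma total_weightE :
  total_weight R col = n%:R * (n%:R - 1) - ordinary_pairs%:R.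
Proof.
rewrite /total_weight S3_pair.
transitivity (\sum_i (n%:R - 1 - (ordinary_degree i)%:R : R)).
  by apply: eq_bigr => i _; rewrite -special_degree; apply: eq_bigr => j _; rewrite mulr1.
by rewrite sumrB sum_const natr_sum.
Qed.

Definition triple := (T * T * T)%type.
Definition tom (r : triple) := om r.1.1 r.1.2 r.2.
(** Squared moduli of the dependency coefficients of a triple, spread over all points: the matrix to
    be scaled. *)
Definition trow (r : triple) (x : T) : R :=
  (x == r.1.1)%:R * sqdist f r.1.2 r.2 + (x == r.1.2)%:R * sqdist f r.2 r.1.1
  + (x == r.2)%:R * sqdist f r.1.1 r.1.2.

Lemma sum_triple (F : T -> T -> T -> R) :
  \sum_(r : triple) F r.1.1 r.1.2 r.2 = \sum_i \sum_j \sum_k F i j k.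
Proof.
by rewrite -(pair_bigA _ (fun p k => F p.1 p.2 k)) /=
  -(pair_bigA _ (fun i j => \sum_k F i j k)).
Qed.

Lemma sum_tom (F : triple -> R) :
  \sum_r tom r * F r = S3 (fun i j k => F (i, j, k)).
Proof.
rewrite /wsum3 -(sum_triple (fun i j k => om i j k * F (i, j, k))).
by apply: eq_bigr => -[[i j] k].
Qed.

Lemma sum_delta (F : T -> R) (i : T) : \sum_x (x == i)%:R * F x = F i.
Proof.
rewrite (bigD1 i) //= eqxx mul1r big1 ?addr0 // => x xi.
by rewrite (negbTE xi) mul0r.
Qed.

Lemma rowsum_trow y i j k : rowsum trow y (i, j, k) = rowN f y i j k.
Proof.
rewrite /rowsum /trow /= /rowN.
rewrite (eq_bigr (fun x => (x == i)%:R * (sqdist f j k * y x) +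
   (x == j)%:R * (sqdist f k i * y x) + (x == k)%:R * (sqdist f i j * y x))); last first.
  by move=> x _; ring.
by rewrite !big_split /= !sum_delta.
Qed.

(** By symmetry each of the three positions of [x] in a triple contributes equally, so control of
    column sums is control of the Gram diagonal. *)
Lemma colsum_trow y x :
  colsum tom trow y x = 3 * diag col f y x.
Proof.
have e a : (x == a)%:R * y x = (x == a)%:R * y a.
  by case: eqP => [->|_]; rewrite ?mul0r.
rewrite /colsum (sum_tom (fun r => trow r x * y x / rowsum trow y r)).
have -> : S3 (fun i j k => trow (i, j, k) x * y x / rowsum trow y (i, j, k)) =
   S3 (fun i j k => (x == i)%:R * share f y i j k + (x == j)%:R * share f y j i k
        + (x == k)%:R * share f y k i j).
  apply: eq_S3 => i j k _; rewrite rowsum_trow /trow /= /share.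
  rewrite -(rowN_C12 f y i j) -(rowN_C12 f y i k) -(rowN_C23 f y i j) (wC f i k).
  set N := (rowN f y i j k)^-1.
  transitivity (sqdist f j k * ((x == i)%:R * y x) * N + sqdist f k i * ((x == j)%:R * y x) * N
    + sqdist f i j * ((x == k)%:R * y x) * N); first by ring.
  by rewrite !e; ring.
rewrite !S3D -(S3C12 hc (fun i j k => (x == i)%:R * share f y i j k)).
have -> : S3 (fun i j k => (x == k)%:R * share f y k i j) =
  S3 (fun i j k => (x == i)%:R * share f y i j k).
  rewrite (S3C23 hc) (S3C12 hc); apply: eq_S3 => i j k _; by [].
have -> : S3 (fun i j k => (x == i)%:R * share f y i j k) = diag col f y x.
  rewrite /wsum3 -[RHS](sum_delta (diag col f y)); apply: eq_bigr => i _.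
  rewrite eq_sym /diag mulr_sumr; apply: eq_bigr => j _.
  by rewrite mulr_sumr; apply: eq_bigr => k _; rewrite mulrCA.
ring.
Qed.

Hypothesis n_ge5 : (4 < n)%N.
Hypothesis light : forall i, (2 * ordinary_degree i <= n - 1)%N.
Hypothesis few : (6 * ordinary_pairs <= n ^ 2)%N.

Lemma trow_ge0 r x : 0 <= trow r x.
Proof. by rewrite /trow !addr_ge0 // mulr_ge0 // nsq_ge0. Qed.

Lemma trow_gt0 i j k x : col i j k ->
  (0 < trow (i, j, k) x) = [|| x == i, x == j | x == k].
Proof.
move=> h; rewrite /trow /=.
have h1 := w_gt0 f_inj (col_distinct hc h).
have h2 := w_gt0 f_inj (col_neq13 hc h); rewrite wC in h2.
have h3 := w_gt0 f_inj (col_neq23 hc h).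
by case: eqP => _; case: eqP => _; case: eqP => _ /=; lra.
Qed.

Lemma trow_design :
  scalable_design tom (total_weight R col) (fun r x => 0 < trow r x).
Proof.
move=> B.
have n0 : 0 < n%:R :> R by rewrite ltr0n; exact: leq_trans n_ge5.
pose chi x : R := (x \in B)%:R.
have sum_chi : \sum_x chi x = #|B|%:R.
  rewrite -sum1_card natr_sum [RHS]big_mkcond /=; apply: eq_bigr => x _.
  by rewrite /chi; case: (x \in B).
have chi01 x : chi x = 0 \/ chi x = 1 by rewrite /chi; case: (x \in B); [right|left].
have -> : \sum_(r | meets (fun r x => 0 < trow r x) B r) tom r =
  S3 (fun i j k => ((i \in B) || (j \in B) || (k \in B))%:R).
  rewrite big_mkcond /= -(sum_tom (fun r => ((r.1.1 \in B) || (r.1.2 \in B) || (r.2 \in B))%:R)).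
  apply: eq_bigr => -[[i j] k] _ /=; rewrite /tom /=.
  case: (boolP (col i j k)) => h; last by rewrite om_eq0 // mul0r; case: ifP.
  have -> : meets (fun r x => 0 < trow r x) B (i, j, k) = (i \in B) || (j \in B) || (k \in B).
    apply/existsP/idP => [[x /andP[xB]]|].
      by rewrite trow_gt0 // => /or3P[] /eqP <-; rewrite xB ?orbT.
    by case/orP => [/orP[]|] hB; [exists i|exists j|exists k]; rewrite hB trow_gt0 // eqxx ?orbT.
  by case: ifP => _; rewrite ?mulr1 ?mulr0.
have ndO : (n%:R : R) * (n%:R - 1) - total_weight R col = ordinary_pairs%:R.
  by rewrite total_weightE; ring.
set b : R := #|B|%:R; set m := total_weight R col in ndO *.
have b0 : 0 <= b by exact: ler0n.
have bn : b <= n%:R by rewrite ler_nat max_card.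
have O0 : 0 <= ordinary_pairs%:R :> R by exact: ler0n.
have fewR : 6 * ordinary_pairs%:R <= n%:R ^+ 2 :> R.
  by rewrite -natrX -natrM ler_nat.
have pairs (D : {set T}) (e : T -> R) : (forall x, e x = (x \in D)%:R) ->
   S3 (fun i j _ => e i * e j) <= #|D|%:R * (#|D|%:R - 1).
  move=> he.
  have sD : \sum_x e x = #|D|%:R.
    rewrite -sum1_card natr_sum [RHS]big_mkcond /=; apply: eq_bigr => x _.
    by rewrite he; case: (x \in D).
  rewrite S3_pair.
  apply: (@le_trans _ _ (\sum_i e i * (\sum_j e j - 1))); last by rewrite -mulr_suml sD.
  apply: ler_sum => i _.
  apply: (@le_trans _ _ (\sum_j (e i * e j - (j == i)%:R * e i))).
    apply: ler_sum => j _; have := @ell_gt0_neq _ _ hc i j.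
    rewrite !he eq_sym; case: (0 < ell i j)%N => [/(_ isT) /negbTE ->|_].
      by rewrite mul1r mul0r subr0.
    rewrite mul0r; case: (eqVneq j i) => [->|_]; last by rewrite mul0r subr0 mulr_ge0.
    by case: (i \in D); rewrite ?(mul1r, mul0r) subrr.
  by rewrite sumrB (sum_delta (fun=> e i)) -mulr_sumr mulrBr mulr1.
(* When [B] is large, pairs avoiding it weigh at most [(n - b) * (n - b - 1)], and the condition
   reduces to [(n - b) * (n * b - O) >= 0], where [O] is the number of ordinary pairs. *)
case: (lerP (ordinary_pairs%:R) (n%:R * b)) => hO.
  have h1 : m - (n%:R - b) * (n%:R - b - 1) <=
      S3 (fun i j k => ((i \in B) || (j \in B) || (k \in B))%:R).
    apply: (@le_trans _ _ (S3 (fun i j k => 1 + (-1) * ((1 - chi i) * (1 - chi j))))).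
      rewrite (S3D _ (fun _ _ _ => 1)) S3Z mulN1r -/m lerD2l lerN2.
      have := pairs (~: B) (fun x => 1 - chi x).
      rewrite cardsCs finset.setCK natrB ?max_card //; apply=> x.
      by rewrite inE /chi; case: (x \in B); rewrite ?subrr ?subr0.
    apply: le_S3 => i j k _; rewrite /chi.
    by case: (i \in B); case: (j \in B); case: (k \in B) => /=; lra.
  apply: (@le_trans _ _ (n%:R * (m - (n%:R - b) * (n%:R - b - 1)))); last first.
    by rewrite ler_pM2l.
  have e : n%:R * (m - (n%:R - b) * (n%:R - b - 1)) - m * b =
     (n%:R - b) * (n%:R * b - ordinary_pairs%:R) by rewrite -ndO; ring.
  by rewrite -subr_ge0 e mulr_ge0 ?subr_ge0.
(* Otherwise [few] makes [B] small, and inclusion-exclusion with the degree bound [light]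
   suffices. *)
have hb : 6 * b <= n%:R.
  have : n%:R * (6 * b) <= n%:R * n%:R by rewrite -expr2; lra.
  by rewrite ler_pM2l.
have h1 : 3 * b * ((n%:R + 1) / 2 - b) <=
     S3 (fun i j k => ((i \in B) || (j \in B) || (k \in B))%:R).
  apply: (@le_trans _ _ (S3 (fun i j k => chi i + chi j + chi k +
     (-1) * (chi i * chi j + chi j * chi k + chi i * chi k)))); last first.
    apply: le_S3 => i j k _; rewrite /chi.
    by case: (i \in B); case: (j \in B); case: (k \in B) => /=; lra.
  rewrite S3D S3Z !S3D.
  rewrite -(S3C12 hc (fun i _ _ => chi i)).
  have -> : S3 (fun _ _ k => chi k) = S3 (fun i _ _ => chi i).
    by rewrite (S3C23 hc) (S3C12 hc).
  have -> : S3 (fun i _ k => chi i * chi k) = S3 (fun i j _ => chi i * chi j).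
    by rewrite (S3C23 hc).
  have -> : S3 (fun _ j k => chi j * chi k) = S3 (fun i j _ => chi i * chi j).
    by rewrite (S3C12 hc) (S3C23 hc).
  have h2 : S3 (fun i j _ => chi i * chi j) <= b * (b - 1) by exact: pairs.
  have h3 : b * ((n%:R - 1) / 2) <= S3 (fun i _ _ => chi i).
    rewrite (S3_pair col (fun i _ => chi i)) /b -sum_chi mulr_suml; apply: ler_sum => i _.
    rewrite -mulr_suml special_degree mulrC ler_wpM2r //.
    have : (2 * ordinary_degree i)%:R <= (n - 1)%:R :> R by rewrite ler_nat.
    rewrite natrM natrB; [lra|exact: leq_trans n_ge5].
  move: h2 h3; lra.
apply: (@le_trans _ _ (n%:R * (3 * b * ((n%:R + 1) / 2 - b)))); last by rewrite ler_pM2l.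
have mle : m <= n%:R * (n%:R - 1) by lra.
apply: (@le_trans _ _ (n%:R * (n%:R - 1) * b)); first by rewrite ler_wpM2r.
rewrite -!mulrA ler_pM2l // mulrC -[3 * _]mulrCA ler_wpM2l //.
lra.
Qed.

Variable g : 'I_4 -> T -> R[i].
Hypothesis g_dep : forall a i j k, col i j k ->
  (f j - f k) * g a i + (f k - f i) * g a j + (f i - f j) * g a k = 0.
Hypothesis g_free : forall c : 'I_4 -> R[i],
  (forall i, \sum_a c a * g a i = 0) -> forall a, c a = 0.

(** An exact scaling would make every diagonal entry [m / (3 * n)], and the claim would follow from
    [trace_bound] and [frobenius_gram]. As the scaling is approximate, the claim is proved up to an
    arbitrary [e]; [n ^ 4 * d <= e] absorbs the errors. *)
Lemma weight_inequality (m : R) : m = total_weight R col ->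
  m ^+ 2 * n%:R <= (n%:R - 4) * (m ^+ 2 + 4 * m * n%:R
     - 1 / 500 * (rich_pairs col)%:R * n%:R).
Proof.
move=> mW; apply/ler_addgt0Pr => e e0.
have n0 : 0 < n%:R :> R by rewrite ltr0n; exact: leq_trans n_ge5.
have n4 : 0 <= n%:R - 4 :> R by rewrite subr_ge0 ler_nat ltnW.
have [d [d0 d1 de]] : exists d : R, [/\ 0 < d, d <= 1 & n%:R ^+ 4 * d <= e].
  have n40 : 0 < n%:R ^+ 4 :> R by rewrite exprn_gt0.
  exists (Num.min 1 (e / n%:R ^+ 4)); split.
  - by rewrite lt_min ltr01 divr_gt0.
  - by rewrite ge_min lexx.
  - by rewrite mulrC -ler_pdivlMr // ge_min lexx orbT.
have om0 r : 0 <= tom r by exact: om_ge0.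
have mE : m = \sum_r tom r.
  by rewrite mW /total_weight -(sum_tom (fun=> 1)); apply: eq_bigr => r _; rewrite mulr1.
have supp r : 0 < tom r -> exists x, 0 < trow r x.
  by case: r => [[i j] k]; rewrite om_gt0 => h; exists i; rewrite trow_gt0 // eqxx.
have des := trow_design; rewrite -mW in des.
have [y [y0 hy]] := approx_scaling om0 mE trow_ge0 des supp d0.
have tr := trace_bound hc y0 n_ge5 g_dep g_free.
have gain := gain_lower_bound hc f_inj y0.
have frob := frobenius_gram hc f_inj y0.
have trD : \sum_i diag col f y i = m / 3.
  by rewrite mW -(S3_q hc f_inj y0).
have dev0 : 0 <= deviation col f y.
  apply: sumr_ge0 => i _; apply: sumr_ge0 => j _; apply: sumr_ge0 => k _.
  by apply: mulr_ge0; [exact: om_ge0|exact: sqr_ge0].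
have var0 : 0 <= variance col f y.
  apply: sumr_ge0 => i _; apply: sumr_ge0 => j _; apply: sumr_ge0 => k _.
  apply: sumr_ge0 => l _; apply: mulr_ge0; last exact: nsq_ge0.
  by apply: mulr_ge0; exact: om_ge0.
(* The [s i] sum to zero, so the one-sided bound [- d] from the scaling also yields an upper bound
   [n * d]. *)
pose s i := n%:R * (3 * diag col f y i) - m.
have s_lb i : - d <= s i by have := hy i; rewrite colsum_trow /s; lra.
have s_sum : \sum_i s i = 0.
  by rewrite /s sumrB -!mulr_sumr trD sum_const; field.
have s_ub i : s i <= n%:R * d.
  move: s_sum; rewrite (bigD1 i) //=.
  have : - (n%:R * d) <= \sum_(j | j != i) s j.
    apply: (@le_trans _ _ (\sum_(j | j != i) - d)); last by apply: ler_sum.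
    rewrite sumr_const -[(- d) *+ _]mulr_natl mulrN lerN2 ler_wpM2r ?(ltW d0) // ler_nat.
    exact: max_card.
  lra.
have s_sq i : s i ^+ 2 <= n%:R ^+ 2 * d.
  have n1 : 1 <= n%:R :> R by rewrite ler1n; exact: leq_trans n_ge5.
  have h1 : s i ^+ 2 <= (n%:R * d) ^+ 2.
    rewrite -subr_ge0 subr_sqr mulr_ge0 ?subr_ge0 //.
    have : d <= n%:R * d by rewrite ler_peMl // ltW.
    have := s_lb i; lra.
  apply: le_trans h1 _; rewrite exprMn ler_wpM2l ?sqr_ge0 // expr2.
  by rewrite ler_piMl // ltW.
have sumD : 9 * n%:R ^+ 2 * \sum_i diag col f y i ^+ 2 <= n%:R * m ^+ 2 + n%:R ^+ 3 * d.
  have -> : 9 * n%:R ^+ 2 * \sum_i diag col f y i ^+ 2 =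
      \sum_i (m ^+ 2 + 2 * m * s i + s i ^+ 2).
    by rewrite mulr_sumr; apply: eq_bigr => i _; rewrite /s; ring.
  rewrite big_split /= big_split /= -(mulr_sumr _ _ _ (2 * m)) s_sum mulr0 addr0 sum_const lerD2l.
  apply: (@le_trans _ _ (\sum_(i : T) n%:R ^+ 2 * d)); first exact: ler_sum.
  by rewrite sum_const le_eqVlt; apply/orP; left; apply/eqP; ring.
move: tr; rewrite trD frob natrB ?(ltnW n_ge5) // => tr.
set SD := \sum_i _ in sumD tr.
set dv := deviation _ _ _ in gain dev0 tr; set va := variance _ _ _ in gain var0 tr.
rewrite -mW in tr.
have n1 : n%:R - 4 <= n%:R :> R by lra.
have h1 : 9 * SD <= m ^+ 2 / n%:R + n%:R * d.
  have : n%:R ^+ 2 * (9 * SD) <= n%:R ^+ 2 * (m ^+ 2 / n%:R + n%:R * d).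
    have -> : n%:R ^+ 2 * (m ^+ 2 / n%:R + n%:R * d) = n%:R * m ^+ 2 + n%:R ^+ 3 * d.
      by field; rewrite gt_eqF.
    by rewrite mulrA [n%:R ^+ 2 * 9]mulrC.
  by rewrite ler_pM2l // exprn_gt0.
(* [gain] gives [dv + va] at least 1/9000 of the rich pairs, and [18 / 9000 = 1 / 500]. *)
have h2 : 9 * (SD + 4 / 9 * m - 2 * dv - 2 * va) <=
   m ^+ 2 / n%:R + n%:R * d + 4 * m - 1 / 500 * (rich_pairs col)%:R.
  move: h1 gain dev0 var0; lra.
have h3 : m ^+ 2 <= (n%:R - 4) *
   (m ^+ 2 / n%:R + n%:R * d + 4 * m - 1 / 500 * (rich_pairs col)%:R).
  apply: (@le_trans _ _ ((n%:R - 4) * (9 * (SD + 4 / 9 * m - 2 * dv - 2 * va)))).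
    by move: tr; rewrite expr_div_n; lra.
  by rewrite ler_wpM2l.
have h4 : m ^+ 2 * n%:R <= (n%:R - 4) *
   (m ^+ 2 / n%:R + n%:R * d + 4 * m - 1 / 500 * (rich_pairs col)%:R) * n%:R.
  by rewrite ler_wpM2r // ltW.
apply: (le_trans h4).
have -> : (n%:R - 4) * (m ^+ 2 / n%:R + n%:R * d + 4 * m - 1 / 500 * (rich_pairs col)%:R) * n%:R
 = (n%:R - 4) * (m ^+ 2 + 4 * m * n%:R - 1 / 500 * (rich_pairs col)%:R * n%:R)
   + (n%:R - 4) * (n%:R ^+ 2 * d) by field; rewrite gt_eqF.
rewrite lerD2l; apply: le_trans de.
apply: (@le_trans _ _ (n%:R * (n%:R ^+ 2 * d))).
  by rewrite ler_wpM2r // mulr_ge0 ?sqr_ge0 // ltW.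
rewrite mulrA -exprS ler_wpM2r ?(ltW d0) // ler_weXn2l // ler1n.
exact: leq_trans n_ge5.
Qed.

(** With [P = N * (N - 4)] the weight inequality reads [m ^ 2 + r * P / 2000 <= m * P]. It forces
    [m <= P], then [m <= P - r / 2000], while [m] is [N * (N - 1)] minus the ordinary pairs. *)
Theorem light_ordinary_pairs :
  3 * n%:R + 1 / 2000 * (rich_pairs col)%:R <= ordinary_pairs%:R :> R.
Proof.
set m := total_weight R col; have H := weight_inequality (erefl m).
have mE : m = n%:R * (n%:R - 1) - ordinary_pairs%:R by exact: total_weightE.
have n5 : 5 <= n%:R :> R by rewrite (ler_nat _ 5).
have fewR : 6 * ordinary_pairs%:R <= n%:R ^+ 2 :> R by rewrite -natrX -natrM ler_nat.
have r0 : 0 <= (rich_pairs col)%:R :> R by exact: ler0n.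
set r := (rich_pairs col)%:R in H r0 *.
set O := ordinary_pairs%:R in mE fewR *.
set N := n%:R in H mE n5 fewR *.
have m0 : 0 < m by rewrite mE; nra.
have P0 : 0 <= N * (N - 4) by rewrite mulr_ge0; lra.
set P := N * (N - 4) in P0.
have H1 : 4 * m ^+ 2 + 1 / 500 * r * P <= 4 * m * P.
  have : (N - 4) * (m ^+ 2 + 4 * m * N - 1 / 500 * r * N) - m ^+ 2 * N =
    4 * m * P - (4 * m ^+ 2 + 1 / 500 * r * P) by rewrite /P; ring.
  lra.
have H2 : m <= P.
  have : m * m <= m * P.
    have : 0 <= r * P by rewrite mulr_ge0.
    by rewrite -expr2; lra.
  by rewrite ler_pM2l.
have H3 : 1 / 500 * r <= 4 * (P - m).
  have h : r * m <= r * P by rewrite ler_wpM2l.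
  have : m * (1 / 500 * r) <= m * (4 * (P - m)) by move: H1; rewrite expr2; lra.
  by rewrite ler_pM2l.
have : P = N * N - 4 * N by rewrite /P; ring.
lra.
Qed.

End AbstractBound.

Local Open Scope fset_scope.
Local Open Scope ring_scope.

(** * Collinearity in a vector space *)

Section AffineCollinearity.
Variables (F : fieldType) (vT : vectType F).

Definition collinear (x y z : vT) :=
  [&& x != y, x != z, y != z & z - x \in <[y - x]>%VS].

Lemma collinearP x y z : reflect
  (exists c, [/\ c != 0, c != 1, x != y & z - x = c *: (y - x)])
  (collinear x y z).
Proof.
apply: (iffP and4P) => [[xy xz yz /vlineP[c e]]|[c [c0 c1 xy e]]].
  exists c; split=> //; apply/eqP => ce; move: e; rewrite ce.
    by rewrite scale0r => /eqP; rewrite subr_eq0 eq_sym (negbTE xz).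
  by rewrite scale1r => /addIr /eqP; rewrite eq_sym (negbTE yz).
have yx : y - x != 0 by rewrite subr_eq0 eq_sym.
split=> //; last by apply/vlineP; exists c.
  by rewrite eq_sym -subr_eq0 e scaler_eq0 negb_or c0.
apply/eqP => yz; move: e; rewrite -yz -{1}[y - x]scale1r => /eqP.
by rewrite -subr_eq0 -scalerBl scaler_eq0 (negbTE yx) orbF subr_eq0 eq_sym (negbTE c1).
Qed.

(** On [z - x = c *: (y - x)] the two swaps act by [1 - c] and [c^-1]; transitivity divides one
    parameter by another. *)
Lemma collinear_collinearity : collinearity collinear.
Proof.
have s12 x y z : collinear x y z -> collinear y x z.
  move/collinearP => [c [c0 c1 xy e]]; apply/collinearP; exists (1 - c).
  rewrite subr_eq0 (eq_sym 1) c1 (eq_sym y) xy; split=> //.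
    by rewrite -subr_eq0 addrAC subrr add0r oppr_eq0.
  have -> : z - y = (z - x) - (y - x) by rewrite opprB addrA subrK.
  by rewrite e -[x - y]opprB scalerN -scaleNr (opprB 1 c) scalerBl scale1r.
have s23 x y z : collinear x y z -> collinear x z y.
  move=> h; have /and4P[_ xz _ _] := h; move: h.
  move/collinearP => [c [c0 c1 xy e]]; apply/collinearP; exists c^-1.
  rewrite invr_eq0 c0 invr_eq1 c1 xz; split=> //.
  by rewrite e scalerA mulVf // scale1r.
split.
- by move=> x y z; apply/idP/idP; exact: s12.
- by move=> x y z; apply/idP/idP; exact: s23.
- by move=> x y z /and4P[].
move=> x y z t hz ht zt.
have /and4P[_ xz _ _] := hz; have /and4P[_ xt _ _] := ht.
have /collinearP[c [c0 c1 xy ez]] := hz.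
have /collinearP[d [d0 d1 _ et]] := ht.
rewrite /collinear xz xt zt /=; apply/vlineP; exists (d / c).
by rewrite et ez scalerA divfK.
Qed.

End AffineCollinearity.

(** * Pair counts in a finite set and deletion of a point *)

Section PairCounts.
Variables (T : choiceType) (col : T -> T -> T -> bool).
Hypothesis hc : collinearity col.

(** Counterparts of the counts over a [finType], stated for finite sets so that deleting a point
    leaves the ambient type fixed. *)
Definition fell (V : {fset T}) x y := (\sum_(z <- V) col x y z)%N.
Definition ford (V : {fset T}) x y := (x != y) && (fell V x y == 0)%N.
Definition fdeg (V : {fset T}) x := (\sum_(y <- V) ford V x y)%N.
Definition fords (V : {fset T}) := (\sum_(x <- V) fdeg V x)%N.
Definition frich (V : {fset T}) := (\sum_(x <- V) \sum_(y <- V) (1 < fell V x y))%N.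

Let colV (V : {fset T}) (i j k : V) := col (val i) (val j) (val k).

Lemma collinearity_sub (V : {fset T}) : collinearity (@colV V).
Proof.
split=> [i j k|i j k|i j k|i j k l]; rewrite /colV.
- exact: (col_swap12 hc).
- exact: (col_swap23 hc).
- by move/(col_distinct hc).
- by move=> h1 h2 kl; apply: (col_transitive hc) h1 h2 _.
Qed.

Lemma fellE (V : {fset T}) (i j : V) : fell V (val i) (val j) = ell (@colV V) i j.
Proof. by rewrite /fell big_seq_fsetE. Qed.

Lemma fordE (V : {fset T}) (i j : V) : ford V (val i) (val j) = ordinary (@colV V) i j.
Proof. by rewrite /ford fellE. Qed.

Lemma fdegE (V : {fset T}) (i : V) : fdeg V (val i) = ordinary_degree (@colV V) i.
Proof. by rewrite /fdeg big_seq_fsetE; apply: eq_bigr => j _; rewrite fordE. Qed.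

Lemma fordsE (V : {fset T}) : fords V = ordinary_pairs (@colV V).
Proof. by rewrite /fords big_seq_fsetE; apply: eq_bigr => i _; rewrite fdegE. Qed.

Lemma frichE (V : {fset T}) : frich V = rich_pairs (@colV V).
Proof.
rewrite /frich big_seq_fsetE; apply: eq_bigr => i _.
by rewrite big_seq_fsetE; apply: eq_bigr => j _; rewrite fellE.
Qed.

Lemma fordC V x y : ford V x y = ford V y x.
Proof.
rewrite /ford eq_sym; congr (_ && (_ == _)); apply: eq_bigr => z _.
by rewrite (col_swap12 hc).
Qed.

Lemma ford_xx V x : ford V x x = false.
Proof. by rewrite /ford eqxx. Qed.

Lemma fell_xx V x : fell V x x = 0%N.
Proof.
rewrite /fell big1 // => z _; case h : (col x x z) => //.
by have := col_distinct hc h; rewrite eqxx.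
Qed.

Section Removal.
Variables (V : {fset T}) (v : T).
Hypothesis vV : v \in V.
Local Notation W := (V `\ v).

Lemma fellD1 x y : fell V x y = (col x y v + fell W x y)%N.
Proof. by rewrite /fell (big_fsetD1 v). Qed.

(* All such y lie on the line xv, so any one of them already counts the others. *)
Lemma line_through_count x r :
  (\sum_(y <- W) (col x y v && (fell W x y == r)) <= r.+1)%N.
Proof.
have [[y0 /andP[y0W /andP[hy0 /eqP er]]]|none] :=
    pselect (exists y, (y \in W) && (col x y v && (fell W x y == r))); last first.
  rewrite big1_fset // => y yW _; case h : (_ && _) => //.
  by case: none; exists y; rewrite yW h.
rewrite (big_fsetD1 y0) //= hy0 er eqxx /= add1n ltnS -{2}er /fell.
rewrite [in X in (_ <= X)%N](big_fsetD1 y0) //= .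
apply: leq_trans (leq_addl _ _).
rewrite big_seq [X in (_ <= X)%N]big_seq; apply: leq_sum => y.
rewrite !inE => /andP[yy0 _].
case: (boolP (col x y v)) => //= hy.
suff -> : col x y0 y by case: (_ == _).
rewrite (col_swap23 hc) in hy0; rewrite (col_swap23 hc) in hy.
by apply: (col_transitive hc) hy0 hy _; rewrite eq_sym.
Qed.

(** Deleting [v] loses [2 * fdeg V v] ordinary pairs. A new one comes from a three-point line
    through [v]: each [x] has at most one such partner, and none if [x v] was itself ordinary. *)
Lemma fords_removal : (fords W + 3 * fdeg V v <= fords V + (#|` V| - 1))%N.
Proof.
have dv : fdeg V v = (\sum_(y <- W) ford V v y)%N.
  by rewrite /fdeg (big_fsetD1 v) //= ford_xx.
have eV : fords V = (\sum_(x <- W) \sum_(y <- W) ford V x y + 2 * fdeg V v)%N.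
  have dx x : fdeg V x = (ford V x v + \sum_(y <- W) ford V x y)%N.
    by rewrite /fdeg (big_fsetD1 v).
  rewrite /fords (big_fsetD1 v) //= (eq_bigr _ (fun x _ => dx x)) big_split /=.
  have -> : (\sum_(i <- W) ford V i v = fdeg V v)%N.
    by rewrite dv; apply: eq_bigr => y _; rewrite fordC.
  lia.
have eW : (fords W + fdeg V v <= \sum_(x <- W) \sum_(y <- W) ford V x y + (#|` V| - 1))%N.
  have -> : (#|` V| - 1 = \sum_(x <- W) 1)%N.
    by rewrite sum1_size (cardfsD1 v V) vV; lia.
  rewrite dv /fords -!big_split; apply: leq_sum => x _ /=.
  rewrite /fdeg.
  have h : (\sum_(y <- W) ford W x y <= \sum_(y <- W) ford V x y +
        \sum_(y <- W) (col x y v && (fell W x y == 0)))%N.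
    rewrite -big_split; apply: leq_sum => y _ /=.
    rewrite /ford fellD1; case: (x != y) => //=.
    by case: (col x y v); case: (fell W x y == 0)%N => //=; rewrite add0n.
  case: (boolP (ford V v x)) => hx; last first.
    rewrite addn0; exact: leq_trans h (leq_add (leqnn _) (line_through_count x 0)).
  suff e0 : (\sum_(y <- W) (col x y v && (fell W x y == 0)) = 0)%N.
    by move: h; rewrite e0 addn0 addn1 addn1 ltnS.
  rewrite big1_fset // => y yW _; case hy : (col x y v) => //=; exfalso.
  move: hx; rewrite /ford => /andP[_]; rewrite /fell (big_fsetD1 y) /=; last first.
    by move: yW; rewrite !inE => /andP[].
  have -> : col v x y by rewrite (col_swap12 hc) (col_swap23 hc).
  by [].
lia.
Qed.

(** At most [2 * (#|V| - 1)] lost pairs contain [v]; the others lie on four-point lines through [v],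
    where each [x] has at most two partners. *)
Lemma frich_removal : (frich V <= frich W + 4 * (#|` V| - 1))%N.
Proof.
have cW : (#|` V| - 1 = \sum_(x <- W) 1)%N.
  by rewrite sum1_size (cardfsD1 v V) vV; lia.
have r1 x : (\sum_(y <- W) (1 < fell V x y) <= \sum_(y <- W) (1 < fell W x y) + 2)%N.
  apply: leq_trans (leq_add (leqnn _) (line_through_count x 1)).
  rewrite -big_split; apply: leq_sum => y _ /=; rewrite fellD1.
  by case: (col x y v); case: (fell W x y) => [|[|k]].
have h1 : (\sum_(y <- W) (1 < fell V v y) <= #|` V| - 1)%N.
  by rewrite cW; apply: leq_sum => y _; case: (1 < _)%N.
have h2 : (\sum_(x <- W) (1 < fell V x v) <= #|` V| - 1)%N.
  by rewrite cW; apply: leq_sum => y _; case: (1 < _)%N.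
rewrite /frich (big_fsetD1 v) //= (big_fsetD1 v) //= fell_xx /=.
have -> : (\sum_(x <- W) \sum_(y <- V) (1 < fell V x y) =
   \sum_(x <- W) (1 < fell V x v) + \sum_(x <- W) \sum_(y <- W) (1 < fell V x y))%N.
  by rewrite -big_split; apply: eq_bigr => x _; rewrite (big_fsetD1 v).
have h3 : (\sum_(x <- W) \sum_(y <- W) (1 < fell V x y) <=
   \sum_(x <- W) \sum_(y <- W) (1 < fell W x y) + 2 * (#|` V| - 1))%N.
  rewrite cW big_distrr -big_split; apply: leq_sum => x _ /=.
  by rewrite muln1.
lia.
Qed.

End Removal.
End PairCounts.

(** * A linear form separating finitely many points *)

Lemma exists_nonroot (F : numFieldType) (p : {poly F}) : p != 0 -> exists t, p.[t] != 0.
Proof.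
move=> p0.
have u : uniq [seq (i%:R : F) | i <- iota 0 (size p)].
  by rewrite map_inj_uniq ?iota_uniq //; apply: mulrIn; rewrite oner_eq0.
have := contraNN (fun x => max_poly_roots p0 x u).
by rewrite size_map size_iota ltnn => /(_ isT) /allPn[a _ ha]; exists a.
Qed.

(** Reading a vector as a polynomial, evaluation at [t] is linear in the vector; the bad [t] are
    roots of the nonzero product of all difference polynomials. *)
Lemma separating_form (F : numFieldType) (d : nat) (V : {fset 'rV[F]_d}) :
  exists t : F, {in V &, injective (fun v => (rVpoly v).[t])}.
Proof.
pose p : {poly F} := \prod_(x <- V) \prod_(y <- V | y != x) rVpoly (x - y).
have p0 : p != 0.
  rewrite /p prodf_seq_neq0; apply/allP => x _ /=; rewrite prodf_seq_neq0.
  apply/allP => y _; apply/implyP => yx; apply: contra_neq yx => /(congr1 (@poly_rV _ d)).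
  by rewrite rVpolyK linear0 => /eqP; rewrite subr_eq0 => /eqP.
have [t ht] := exists_nonroot p0; exists t => x y xV yV /= exy.
apply/eqP; apply: contraT => xy; move: ht.
rewrite /p horner_prod prodf_seq_neq0 => /allP /(_ x xV) /=.
rewrite horner_prod prodf_seq_neq0 => /allP /(_ y yV) /=.
by rewrite eq_sym xy /= raddfB /= hornerD hornerN exy subrr eqxx.
Qed.

(** * Point sets in complex 3-space *)

Section SpaceGeometry.
Variable R : realType.
Local Notation C := (R[i]).
Local Notation P := ('rV[C]_3).

(** The constant function and the three coordinates: four functions killed by every affine
    dependency. *)
Definition affine_coord (a : 'I_4) (v : P) : C :=
  if unlift ord0 a is Some k then v 0 k else 1.

Lemma sum_affine_coord (c : 'I_4 -> C) (v : P) :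
  \sum_a c a * affine_coord a v = c ord0 + \sum_(k < 3) c (lift ord0 k) * v 0 k.
Proof.
rewrite big_ord_recl /affine_coord unlift_none mulr1; congr (_ + _).
by apply: eq_bigr => k _; rewrite liftK.
Qed.

Lemma affine_coord_line (a : 'I_4) (x y z : P) (c : C) :
  z - x = c *: (y - x) ->
  affine_coord a z - affine_coord a x = c * (affine_coord a y - affine_coord a x).
Proof.
rewrite /affine_coord; case: unliftP => [k _|_] e; last by rewrite !subrr mulr0.
by have /rowP/(_ k) := e; rewrite !mxE.
Qed.

Lemma hyperplane_plane (c : 'cV[C]_3) (p : P) : c != 0 ->
  is_plane [set x : P | (x - p) *m c = 0]%classic.
Proof.
move=> c0; pose h : 'Hom(P, 'rV[C]_1) := linfun (mulmxr c).
exists p, (lker h); split; last first.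
  apply/seteqP; split=> x /=; rewrite memv_ker lfunE /=; first by move=> ->.
  by move/eqP.
have := limg_ker_dim h fullv; rewrite capfv dimvf /dim /= mul1n.
suff -> : \dim (limg h) = 1%N by rewrite addn1 => -[].
apply/eqP; rewrite eqn_leq; apply/andP; split.
  by apply: leq_trans (dimvS (subvf _)) _; rewrite dimvf.
rewrite lt0n dimv_eq0; apply: contra_neq c0 => h0.
apply/matrixP => k j; rewrite mxE ord1.
have : h (delta_mx 0 k) \in limg h by rewrite memv_img ?memvf.
rewrite h0 memv0 lfunE /= -rowE => /eqP/rowP/(_ 0).
by rewrite !mxE.
Qed.

Lemma light_fset (V : {fset P}) :
  (4 < #|` V|)%N ->
  (forall H, is_plane H -> exists2 x, x \in V & ~ H x) ->
  (forall x, x \in V -> (2 * fdeg (@collinear _ _) V x <= #|` V| - 1)%N) ->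
  (6 * fords (@collinear _ _) V <= #|` V| ^ 2)%N ->
  3 * (#|` V|)%:R + 1 / 2000 * (frich (@collinear _ _) V)%:R
    <= (fords (@collinear _ _) V)%:R :> R.
Proof.
move=> n5 spat light few.
have [t ft] := separating_form V.
have hc := @collinear_collinearity _ P.
pose f (v : V) : C := (rVpoly (val v)).[t].
have f_inj : injective f.
  by move=> x y /(ft _ _ (valP x) (valP y)) /val_inj.
have hcV := collinearity_sub hc V.
rewrite frichE fordsE cardfE.
apply: (light_ordinary_pairs hcV f_inj _ _ _ (g := fun a v => affine_coord a (val v))).
- by rewrite -cardfE.
- by move=> i; rewrite -fdegE -cardfE; apply: light; exact: valP.
- by rewrite -fordsE -cardfE.
- move=> a x y z /= /collinearP[c [_ _ _ e]].
  have ef : f z - f x = c * (f y - f x).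
    by rewrite /f -!hornerN -!hornerD -!raddfB /= e linearZ hornerZ.
  have eg := affine_coord_line a e.
  move: eg ef; set gx := affine_coord a (val x); set gy := affine_coord a (val y).
  set gz := affine_coord a (val z) => eg ef.
  have -> : f z = f x + c * (f y - f x) by rewrite -ef addrC subrK.
  have -> : gz = gx + c * (gy - gx) by rewrite -eg addrC subrK.
  ring.
(* A relation [c] among the four functions with nonzero linear part would place all of [V] in one
   plane. *)
move=> c hv.
pose c' : 'cV[C]_3 := \col_k c (lift ord0 k).
have hV v : v \in V -> v *m c' = (- c ord0)%:M.
  move=> vV; have := hv [` vV]; rewrite sum_affine_coord /= => /eqP.
  rewrite addr_eq0 => /eqP e.
  apply/matrixP => i j; rewrite !ord1 !mxE eqxx mulr1n e opprK.
  by apply: eq_bigr => k _; rewrite !mxE mulrC.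
have [p pV] : exists p, p \in V by apply/fset0Pn; rewrite -cardfs_gt0; apply: leq_trans n5.
have c'0 : c' = 0.
  apply/eqP; apply: contraT => c'0.
  have [x xV []] := spat _ (hyperplane_plane p c'0).
  by rewrite /= mulmxBl !hV // subrr.
have c00 : c ord0 = 0.
  have := hV _ pV; rewrite c'0 mulmx0 => /matrixP /(_ 0 0).
  by rewrite !mxE eqxx mulr1n => /eqP; rewrite eq_sym oppr_eq0 => /eqP.
move=> a; case: (unliftP ord0 a) => [k ->|->//].
by have /matrixP /(_ k 0) := c'0; rewrite !mxE.
Qed.

End SpaceGeometry.

(** * From numbers of lines to numbers of ordered pairs *)

Section LineCounts.
Variables (F : fieldType) (vT : vectType F) (V : {fset vT}).
Local Notation fellV := (fell (@collinear F vT) V).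

Lemma npoints_onE (L : set vT) :
  npoints_on V L = (\sum_(x <- V) (x \in L))%N.
Proof.
rewrite /npoints_on -sum1_size -big_fset_condE big_mkcond /=.
by apply: eq_bigr => x _; case: (x \in L).
Qed.

Definition line_through (x y : vT) : set vT := [set z | z - x \in <[y - x]>%VS]%classic.

Lemma line_throughP x y : x != y ->
  [/\ is_line (line_through x y), x \in line_through x y & y \in line_through x y].
Proof.
move=> xy; split.
- by exists x, <[y - x]>%VS; rewrite dim_vline subr_eq0 eq_sym xy.
- by rewrite inE /line_through /= subrr mem0v.
- by rewrite inE /line_through /= memv_line.
Qed.

Lemma npoints_line_through x y : x \in V -> y \in V -> x != y ->
  npoints_on V (line_through x y) = (fellV x y).+2.
Proof.
move=> xV yV xy; have [_ xL yL] := line_throughP xy.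
have yVx : y \in V `\ x by rewrite !inE eq_sym xy.
rewrite npoints_onE (big_fsetD1 x) //= (big_fsetD1 y) //= xL yL !add1n; congr _.+2.
rewrite /fell [RHS](big_fsetD1 x) //= [X in _ = (_ + X)%N](big_fsetD1 y) //=.
rewrite {1 2}/collinear !eqxx /= !andbF add0n add0n.
rewrite big_seq [RHS]big_seq; apply: eq_bigr => z.
rewrite !inE => /and3P[zy zx _]; rewrite /collinear xy eq_sym zx eq_sym zy /=.
by congr nat_of_bool; apply/idP/idP; rewrite inE.
Qed.

Lemma sum_lines_through r x y : (1 < r)%N -> x \in V -> y \in V -> x != y ->
  (\sum_(L <- fset_set (lines_with V r)) ((x \in L) && (y \in L)) =
   ((fellV x y).+2 == r))%N.
Proof.
move=> r2 xV yV xy; have [lL xL yL] := line_throughP xy.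
have uniqL L : is_line L -> x \in L -> y \in L -> L = line_through x y.
  by move=> lL' /set_mem xL' /set_mem yL'; exact: is_lineE.
have fin := finite_lines_with V r2.
case: eqP => e.
  have LL : line_through x y \in fset_set (lines_with V r).
    by rewrite in_fset_set // inE; split=> //; rewrite npoints_line_through.
  rewrite (big_fsetD1 _ LL) /= xL yL big1_fset // => L.
  rewrite !inE => /andP[LN]; rewrite in_fset_set // inE => -[lL' _] _.
  case: (boolP (x \in L)) => //= xL'; case: (boolP (y \in L)) => //= yL'.
  by rewrite (uniqL L) // eqxx in LN.
rewrite big1_fset // => L; rewrite in_fset_set // inE => -[lL' nL] _.
case: (boolP (x \in L)) => //= xL'; case: (boolP (y \in L)) => //= yL'.
by case: e; rewrite -npoints_line_through // -(uniqL L).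
Qed.

(** Double counting of lines with exactly [r] points together with an ordered pair of distinct
    points on them. *)
Lemma t_pairs r : (1 < r)%N ->
  (t_ r V * (r * (r - 1)) =
   \sum_(x <- V) \sum_(y <- V) ((x != y) && ((fellV x y).+2 == r)))%N.
Proof.
move=> r2; have fin := finite_lines_with V r2.
transitivity (\sum_(x <- V) \sum_(y <- V) \sum_(L <- fset_set (lines_with V r))
   ((x != y) && (x \in L) && (y \in L)))%N; last first.
  rewrite big_seq [RHS]big_seq; apply: eq_bigr => x xV.
  rewrite big_seq [RHS]big_seq; apply: eq_bigr => y yV.
  have [->|xy] /= := eqVneq x y; first by rewrite big1.
  exact: sum_lines_through.
rewrite (eq_bigr _ (fun x _ => exchange_big _ _ _ _ _ _)) /= exchange_big /=.
rewrite /t_ -sum1_size big_distrl /= big_seq [RHS]big_seq; apply: eq_bigr => L.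
rewrite in_fset_set // inE => -[_ nL]; rewrite mul1n.
rewrite npoints_onE in nL.
transitivity (\sum_(x <- V) (x \in L) * (r - 1))%N.
  by rewrite -big_distrl /= nL.
rewrite big_seq [RHS]big_seq; apply: eq_bigr => x xV.
case: (boolP (x \in L)) => xL; last first.
  by rewrite mul0n big1 // => y _; rewrite andbF.
rewrite mul1n -nL (big_fsetD1 x) //= xL add1n subn1 /=.
rewrite [RHS](big_fsetD1 x) //= eqxx /= add0n.
rewrite big_seq [RHS]big_seq; apply: eq_bigr => y.
by rewrite !inE eq_sym => /andP[-> _].
Qed.

Lemma t2_fords : (2 * t_ 2 V = fords (@collinear _ _) V)%N.
Proof.
by rewrite mulnC (t_pairs (r := 2)) //; apply: eq_bigr => x _; apply: eq_bigr => y _.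
Qed.

Lemma rich_lines_frich :
  (3 * \sum_(4 <= r < (#|` V|).+1) r ^ 2 * t_ r V <= 4 * frich (@collinear _ _) V)%N.
Proof.
rewrite !big_distrr /=.
apply: (@leq_trans (4 * \sum_(4 <= r < (#|` V|).+1)
   \sum_(x <- V) \sum_(y <- V) ((x != y) && ((fellV x y).+2 == r)))).
  rewrite big_distrr /= !big_nat; apply: leq_sum => r /andP[r4 _].
  rewrite -t_pairs; last exact: leq_trans r4.
  (* Equality holds at [r = 4]. *)
  have : (3 * r ^ 2 <= 4 * (r * (r - 1)))%N by nia.
  move=> h; rewrite mulnA [(t_ r V * _)%N]mulnC [(4 * (_ * _))%N]mulnA.
  by rewrite leq_mul2r h orbT.
rewrite -!big_distrr leq_mul2l /= exchange_big; apply: leq_sum => x _.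
rewrite exchange_big; apply: leq_sum => y _ /=.
case: (ltnP 1 (fellV x y)) => h.
  case: (ltnP (fellV x y).+2 (#|` V|).+1) => h'; last first.
    rewrite big_nat big1 // => r /andP[_ hr]; rewrite gtn_eqF ?andbF //.
    exact: leq_trans h'.
  rewrite (bigD1_seq (fellV x y).+2) /= ?mem_index_iota ?iota_uniq ?h' ?ltnS ?h //.
  rewrite big1 ?addn0 ?leq_b1 // => r rN.
  by rewrite (eq_sym _ r) (negbTE rN) andbF.
rewrite big_nat big1 // => r /andP[hr _]; rewrite ltn_eqF ?andbF //.
by apply: leq_trans hr.
Qed.

End LineCounts.

(** * Arithmetic of the deletion process *)

Lemma removal_arith_linear (R : realFieldType) (n a a' o o' r r' : R) :
  a = a' + 1 -> 100 <= n -> 5 * n < 6 * a -> 2 * o' + a + 2 <= 2 * o ->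
  r <= r' + 4 * a -> 3 * a' + 1 / 2000 * r' <= o' -> 3 * a + 1 / 2000 * r <= o.
Proof. move=> ->; lra. Qed.

(** One more point costs [6 * n] on the left and gains over [12 * a] on the right, with
    [12 * a > 10 * n]. *)
Lemma removal_arith_quadratic (R : realFieldType) (n a a' o o' : R) :
  a = a' + 1 -> 100 <= n -> 5 * n < 6 * a -> 2 * o' + a + 2 <= 2 * o ->
  n * (6 * a' - 5 * n) <= 24 * o' -> n * (6 * a - 5 * n) <= 24 * o.
Proof. move=> ->; lra. Qed.

Lemma dense_arith (R : realFieldType) (n a o r : R) :
  100 <= n -> 5 * n < 6 * a -> a ^+ 2 < 6 * o -> r <= a ^+ 2 ->
  3 * a + 1 / 2000 * r <= o.
Proof.
move=> hn ha ho hr; have : 80 * a <= a ^+ 2 by rewrite expr2 ler_pM2r; lra.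
lra.
Qed.

(** * Deletion of heavy points and the final bound *)

Section Main.
Variable R : realType.
Local Notation P := ('rV[R[i]]_3).
Local Notation fords := (fords (@collinear _ P)).
Local Notation fdeg := (fdeg (@collinear _ P)).
Local Notation frich := (frich (@collinear _ P)).

Lemma frich_le (A : {fset P}) : (frich A <= #|` A| ^ 2)%N.
Proof.
apply: (@leq_trans (\sum_(x <- A) \sum_(y <- A) 1)%N).
  by apply: leq_sum => x _; apply: leq_sum => y _; case: (1 < _)%N.
by rewrite sum1_size big_const_seq count_predT iter_addn_0 -mulnn.
Qed.

Variable V : {fset P}.
Local Notation n := #|` V|.
Hypothesis n_large : (100 <= n)%N.
Hypothesis spatial : forall H : set P, is_plane H -> (3 * npoints_on V H <= 2 * n)%N.

(* Deleting a heavy point gains about |A|/2 ordinary pairs, so after n/6 deletions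
   the second alternative alone is already quadratic in n. *)
Lemma subset_dichotomy (A : {fset P}) : A `<=` V ->
  (3 * (#|` A|)%:R + 1 / 2000 * (frich A)%:R <= (fords A)%:R :> R) \/
  (n%:R * (6 * (#|` A|)%:R - 5 * n%:R) <= 24 * (fords A)%:R :> R).
Proof.
have [k] := ubnP #|` A|; elim: k => // k IH in A *; rewrite ltnS => hk AV.
have nR : 100 <= n%:R :> R by rewrite (ler_nat _ 100).
have O0 : 0 <= (fords A)%:R :> R by exact: ler0n.
(* Once at most 5/6 of the points remain, the left side of the second alternative is not
   positive. *)
case: (leqP (6 * #|` A|) (5 * n)) => hA.
  right; apply: (@le_trans _ _ 0); last by rewrite mulr_ge0.
  rewrite mulr_ge0_le0 // subr_le0 -!natrM ler_nat //.
have hAR : 5 * n%:R < 6 * (#|` A|)%:R :> R by rewrite -!natrM ltr_nat.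
case: (pselect (exists2 v, v \in A & ~~ (2 * fdeg A v <= #|` A| - 1)%N)) => [[v vA hv]|light].
  have c1 : #|` A| = (#|` A `\ v|).+1 by rewrite (cardfsD1 v A) vA.
  have h1 := fords_removal (@collinear_collinearity _ P) vA.
  have h2 := frich_removal (@collinear_collinearity _ P) vA.
  have cR : (#|` A|)%:R = (#|` A `\ v|)%:R + 1 :> R by rewrite c1 -natr1.
  have aux (o o' d a : nat) : (0 < a)%N -> ~~ (2 * d <= a - 1)%N ->
      (o' + 3 * d <= o + (a - 1))%N -> (2 * o' + a + 2 <= 2 * o)%N by lia.
  have h1R : 2 * (fords (A `\ v))%:R + (#|` A|)%:R + 2 <= 2 * (fords A)%:R :> R.
    by rewrite -!natrM -!natrD ler_nat; apply: aux hv h1; rewrite c1.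
  have [] := IH (A `\ v).
  - by rewrite -ltnS -c1.
  - by apply: fsubset_trans AV; exact: fsubD1set.
  - move=> h3; left.
    have h2R : (frich A)%:R <= (frich (A `\ v))%:R + 4 * (#|` A|)%:R :> R.
      rewrite -natrM -natrD ler_nat; apply: leq_trans h2 _.
      by rewrite leq_add2l leq_mul2l leq_subr orbT.
    (* The gain of at least [#|A| / 2 + 1] pairs covers the increase 3 of the linear term and the at
       most [4 * #|A| / 2000] from rich pairs. *)
    exact: (removal_arith_linear cR nR hAR h1R h2R).
  by move=> h3; right; exact: (removal_arith_quadratic cR nR hAR h1R).
left; case: (leqP (6 * fords A) (#|` A| ^ 2)) => few.
  apply: light_fset => //.
  - move: hA n_large; lia.
  (* [A] keeps more than 5/6 of the points, while a plane holds at most 2/3 of them. *)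
  - move=> H pH; case: (pselect (exists2 x, x \in A & ~ H x)) => // none; exfalso.
    have : (#|` A| <= npoints_on V H)%N.
      apply: fsubset_leq_card; apply/fsubsetP => x xA; rewrite !inE (fsubsetP AV) //=.
      rewrite inE; case: (pselect (H x)) => // hx; case: none; by exists x.
    move: (spatial pH) hA n_large; lia.
  - move=> x xA; apply: contraT => hx; case: light; by exists x.
have fewR : (#|` A|)%:R ^+ 2 < 6 * (fords A)%:R :> R.
  by rewrite -natrX -natrM ltr_nat.
have rR : (frich A)%:R <= (#|` A|)%:R ^+ 2 :> R by rewrite -natrX ler_nat frich_le.
exact: (dense_arith nR hAR fewR rR).
Qed.

(** For [A = V] the second alternative gives at least [n ^ 2 / 24] pairs, more than
    [3 * n + n ^ 2 / 2000] once [n >= 100]. *)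
Lemma fords_lower_bound :
  3 * n%:R + 1 / 2000 * (frich V)%:R <= (fords V)%:R :> R.
Proof.
have [//|h] := subset_dichotomy (fsubset_refl V).
have nR : 100 <= n%:R :> R by rewrite (ler_nat _ 100).
have rR : (frich V)%:R <= n%:R ^+ 2 :> R by rewrite -natrX ler_nat frich_le.
have : 100 * n%:R <= n%:R ^+ 2 :> R by rewrite expr2 ler_pM2r //; lra.
have : n%:R * (6 * n%:R - 5 * n%:R) = n%:R ^+ 2 :> R by ring.
lra.
Qed.

End Main.

Local Open Scope fset_scope.
Local Open Scope classical_set_scope.
Local Open Scope ring_scope.

Theorem theorem1p9 (R : realType) :
  exists c : R, 0 < c /\ exists n0 : nat, (0 < n0)%N /\
    forall V : {fset 'rV[R[i]]_3},
      (n0 <= #|` V |)%N ->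
      (forall H : set 'rV[R[i]]_3, is_plane H ->
         (npoints_on V H)%:R <= 2 / 3 * (#|` V |)%:R :> R) ->
      (t_ 2 V)%:R >= 3 / 2 * (#|` V |)%:R
                     + c * \sum_(4 <= r < (#|` V |).+1) r%:R ^+ 2 * (t_ r V)%:R.
Proof.
(* [1 / 2000] is halved because ordinary pairs are ordered, then multiplied by the 3/4 of
   [rich_lines_frich]. *)
exists (3 / 16000); split; first by lra.
exists 100%N; split=> // V nV planes.
have sp H : is_plane H -> (3 * npoints_on V H <= 2 * #|` V|)%N.
  by move=> /planes h; rewrite -(ler_nat R) !natrM; lra.
have := fords_lower_bound nV sp.
have h2 : 2 * (t_ 2 V)%:R = (fords (@collinear _ _) V)%:R :> R.
  by rewrite -natrM t2_fords.
have h4 : 3 * \sum_(4 <= r < (#|` V |).+1) r%:R ^+ 2 * (t_ r V)%:R <=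
    4 * (frich (@collinear _ _) V)%:R :> R.
  have := rich_lines_frich V; rewrite -(ler_nat R) !natrM natr_sum.
  congr (_ * _ <= _); apply: eq_bigr => r _; by rewrite natrM natrX.
lra.
Qed.
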